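(* Let $\mathcal{G}=(\mathcal{V},\mathcal{E})$ be a generically $d$-rigid graph on $n$ vertices, let $p^*\in\mathbb{R}^{dn}$ be a regular point of the distance map $F$ (that is, $p^*\in\mathcal{C}$), and let $m^*=F(p^* )$, so that $(p^*,m^* )\in\mathcal{S}$. Let a controller in the edge-driven family be given by state-dependent linear maps $\nu_{(p,m)}:\mathbb{R}^{|\mathcal{E}|}\to\mathbb{R}^{dn}$ and $\eta_{(p,m)}:\mathbb{R}^{|\mathcal{E}|}\to\mathbb{R}^{|\mathcal{E}|}$. Suppose that for some neighborhood $V\subseteq\mathcal{S}$ of $(p^*,m^* )$ the linear transformations $\nu_{(p,m)}$ and $\eta_{(p,m)}$ are rational functions of $(p,m)\in V$. Put $\eta^*:=\eta_{(p^*,m^* )}$. If the quadratic form $q_{\eta^*}(x)=\langle x,\eta^*x\rangle$ restricted to $T_{m^*}\mathcal{Q}$ is positive definite, then there is a neighborhood $U\subseteq\mathcal{S}$ of $(p^*,m^* )$ such that, for every initial condition $(p^0,F(p^0))\in U$, the solution of $$\dot p=\nu_{(p,m)}(m^*-m),\qquad \dot m=\eta_{(p,m)}(m^*-m)$$ converges to a state $(q,m^* )$ with $q$ congruent to $p^*$. Moreover, the edge dynamics on $\mathcal{Q}$ and the node dynamics on $\mathcal{C}$ are locally exponentially stable.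
   Context: Setting. $\mathcal{G}=(\mathcal{V},\mathcal{E})$ is a finite simple undirected graph with $\mathcal{V}=\{1,\dots,n\}$, and $d\ge 1$. A configuration is $p=(p_1,\dots,p_n)\in(\mathbb{R}^d)^n=\mathbb{R}^{dn}$. Two configurations are congruent if they differ by an isometry of $\mathbb{R}^d$ applied to all points. All inner products and norms are Euclidean (induced norm for operators). Distance map: $F:\mathbb{R}^{dn}\to\mathbb{R}^{|\mathcal{E}|}$, $F(p)=(\|p_j-p_i\|^2)_{ij\in\mathcal{E}}$. Rigidity matrix: $R(p)\in\mathbb{R}^{|\mathcal{E}|\times dn}$; the row of the edge $ij$ has $(p_i-p_j)^\top$ in the block of columns of vertex $i$, $(p_j-p_i)^\top$ in the block of vertex $j$, and zeros elsewhere. Thus $R(p)p=F(p)$ and $\mathrm{d}F_p=2R(p)$. Regular values and points: let $r=\max_p\mathrm{rk}\,R(p)$. $\mathcal{Q}$ is the set of regular values of $F$: the points $m\in\mathrm{Im}\,F$ near which $\mathrm{Im}\,F$ is an embedded smooth submanifold of $\mathbb{R}^{|\mathcal{E}|}$ of dimension $r$ and such that $\mathrm{rk}\,R(p)=r$ for every $p\in F^{-1}(m)$. It is a smooth semialgebraic set, open and dense in $\mathrm{Im}\,F$. $\mathcal{C}:=F^{-1}(\mathcal{Q})$ is the set of regular points. For $m=F(p)\in\mathcal{Q}$, $T_m\mathcal{Q}=\mathrm{Im}\,R(p)$. Rigidity: $(\mathcal{G},p)$ is locally rigid if there is a neighborhood of $p$ in which every $q$ with $F(q)=F(p)$ is congruent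 to $p$. $\mathcal{G}$ is (generically) $d$-rigid if $(\mathcal{G},p)$ is locally rigid for every regular $p$ (equivalently, for every generic $p$). State space: $\mathcal{S}=\{(p,m)\in\mathcal{C}\times\mathcal{Q}:F(p)=m\}$, with $T_{(p,m)}\mathcal{S}=\{(\dot p,\dot m):\dot m=2R(p)\dot p\}$. Edge-driven controller family: a controller is given by linear maps $\nu_{(p,m)}:\mathbb{R}^{|\mathcal{E}|}\to\mathbb{R}^{dn}$ and $\eta_{(p,m)}:\mathbb{R}^{|\mathcal{E}|}\to\mathbb{R}^{|\mathcal{E}|}$, depending on $(p,m)\in\mathcal{S}$ (they may be defined only on an open neighborhood of $(p^*,m^* )$ in $\mathcal{S}$), such that $(\nu_{(p,m)}x,\eta_{(p,m)}x)\in T_{(p,m)}\mathcal{S}$ for all states and all $x\in\mathbb{R}^{|\mathcal{E}|}$, i.e. $\eta_{(p,m)}=2R(p)\nu_{(p,m)}$. Given a target $(p^*,m^* )$ and a starting configuration $p^0$, the controller is the initial value problem $\dot p=\nu_{(p,m)}(m^*-m)$, $\dot m=\eta_{(p,m)}(m^*-m)$ with $p(0)=p^0$, $m(0)=F(p^0)$; its solution $(p(t),m(t))$ lies in $\mathcal{S}$. The edge dynamics is $m(t)\in\mathcal{Q}$ and the node dynamics is $p(t)\in\mathcal{C}$. Local exponential stability means the following, for some neighborhood $U\subseteq\mathcal{S}$ of $(p^*,m^* )$. Edge dynamics: there are $C,c>0$ such that for all initial conditions in $U$ and all $t\ge0$, $\|m^*-m(t)\|\le Ce^{-ct}$. Node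 dynamics: there are $K,k>0$ such that for every initial condition in $U$ there is a configuration $q$ congruent to $p^*$ with $\|q-p(t)\|\le Ke^{-kt}$ for all $t\ge0$. *)

(* Defs.v *)
From HB Require Import structures.
From mathcomp Require Import all_boot all_order all_algebra.
From mathcomp Require Import all_classical all_reals all_analysis.
(* Not imported: the notations of mpoly clash with those of mathcomp-analysis. *)
From mathcomp Require mpoly.

Set Implicit Arguments.
Unset Strict Implicit.
Unset Printing Implicit Defensive.

Import Order.TTheory GRing.Theory Num.Theory.
Import numFieldNormedType.Exports.

Local Open Scope classical_set_scope.
Local Open Scope ring_scope.

(* The norm `|_| that the library puts on matrices is the sup norm; it is used
   here only for its topology, and the Euclidean norm is the one below. *)
Definition inner (R : realType) (k : nat) (x y : 'cV[R]_k) : R :=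
  \sum_i x i ord0 * y i ord0.

Definition enorm (R : realType) (k : nat) (x : 'cV[R]_k) : R :=
  Num.sqrt (inner x x).

(* f is C^k (C^oo) on A, in the Frechet sense; meant for A open.  In finite
   dimension, x |-> 'd f x is C^k iff x |-> 'd f x v is C^k for every v. *)
Fixpoint Ck_on (R : realType) (V W : normedModType R) (k : nat) (A : set V)
    (f : V -> W) {struct k} : Prop :=
  match k with
  | 0 => forall x, A x -> {for x, continuous f}
  | k'.+1 => (forall x, A x -> differentiable f x) /\
             (forall v, Ck_on k' A (fun x => 'd f x v))
  end.

Definition smooth_on (R : realType) (V W : normedModType R) (A : set V)
    (f : V -> W) : Prop :=
  forall k, Ck_on k A f.

(* Near x, the set M is an embedded smooth submanifold of R^N of dimension r:
   there is a diffeomorphism phi (with inverse psi) from an open W containing x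
   onto an open W', sending M `&` W onto the part of W' in R^r x {0}. *)
Definition embedded_submanifold_near (R : realType) (N : nat)
    (M : set 'cV[R]_N) (r : nat) (x : 'cV[R]_N) : Prop :=
  (r <= N)%N /\
  exists (W W' : set 'cV[R]_N) (phi psi : 'cV[R]_N -> 'cV[R]_N),
    [/\ open W /\ W x, open W', smooth_on W phi /\ smooth_on W' psi,
        (forall y, W y -> W' (phi y) /\ psi (phi y) = y) /\
        (forall z, W' z -> W (psi z) /\ phi (psi z) = z) &
        forall y, W y ->
          (M y <-> forall i : 'I_N, (r <= i)%N -> phi y i ord0 = 0)].

Definition tangent_space (R : realType) (V : normedModType R) (M : set V)
    (x : V) : set V :=
  [set v | exists (g : R -> V) (e : R),
     [/\ 0 < e, smooth_on [set t : R | `|t| < e] g, g 0 = x,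
         forall t : R, `|t| < e -> M (g t) & 'D_1 g 0 = v]].

(* V is a neighborhood of x in the subspace S. *)
Definition nbhd_in (T : topologicalType) (S : set T) (x : T) (V : set T) :
    Prop :=
  V `<=` S /\ within S (nbhs x) V.

Definition open_in (T : topologicalType) (S D : set T) : Prop :=
  exists2 O, open O & D = O `&` S.

Record sgraph (n : nat) := SGraph {
  adj : rel 'I_n;
  adj_sym : symmetric adj;
  adj_irr : irreflexive adj }.

(* Each undirected edge is represented once, as the pair (i, j) with i < j. *)
Definition edges (n : nat) (G : sgraph n) : {set 'I_n * 'I_n} :=
  [set x : 'I_n * 'I_n | (x.1 < x.2)%N && adj G x.1 x.2].

Notation nedges G := #|edges G|.

Definition src (n : nat) (G : sgraph n) (k : 'I_(nedges G)) : 'I_n :=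
  (enum_val k).1.
Definition dst (n : nat) (G : sgraph n) (k : 'I_(nedges G)) : 'I_n :=
  (enum_val k).2.

(* A configuration is a column vector of R^(n*d); coordinate a of the point of
   vertex i is the entry of index [mxvec_index i a]. *)
Definition point (R : realType) (n d : nat) (p : 'cV[R]_(n * d)) (i : 'I_n) :
    'cV[R]_d :=
  \col_a p (mxvec_index i a) ord0.

Definition congruent (R : realType) (n d : nat) (p q : 'cV[R]_(n * d)) : Prop :=
  exists2 f : 'cV[R]_d -> 'cV[R]_d,
    forall x y, enorm (f x - f y) = enorm (x - y) &
    forall i, point q i = f (point p i).

Section Framework.
Variables (R : realType) (n d : nat) (G : sgraph n).

Local Notation config := 'cV[R]_(n * d).
Local Notation edgevec := 'cV[R]_(nedges G).
Local Notation state := (config * edgevec)%type.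

Definition distmap (p : config) : edgevec :=
  \col_k enorm (point p (dst k) - point p (src k)) ^+ 2.

Definition rigidity_mx (p : config) : 'M[R]_(nedges G, n * d) :=
  \matrix_k mxvec (\matrix_(v < n, a < d)
    if v == src k then (point p (src k) - point p (dst k)) a ord0
    else if v == dst k then (point p (dst k) - point p (src k)) a ord0
    else 0).

Definition max_rank : nat :=
  \max_(k < (nedges G).+1 | `[< exists p, \rank (rigidity_mx p) = k >]) k.

Definition regular_values : set edgevec :=
  [set m | [/\ range distmap m,
     embedded_submanifold_near (range distmap) max_rank m &
     forall p, distmap p = m -> \rank (rigidity_mx p) = max_rank]].

Definition regular_points : set config := distmap @^-1` regular_values.

Definition locally_rigid (p : config) : Prop :=
  \forall q \near p, distmap q = distmap p -> congruent p q.

Definition generically_rigid : Prop :=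
  forall p, regular_points p -> locally_rigid p.

Definition state_space : set state :=
  [set s | [/\ regular_points s.1, regular_values s.2 & distmap s.1 = s.2]].

Definition state_tangent (s : state) : set state :=
  [set v | v.2 = 2 *: (rigidity_mx s.1 *m v.1)].

Section Controller.
(* The maps nu and eta are meaningful only on the domain D. *)
Variables (D : set state).
Variables (nu : state -> 'M[R]_(n * d, nedges G)).
Variables (eta : state -> 'M[R]_(nedges G, nedges G)).

Definition edge_driven : Prop :=
  forall s, D s -> forall x : edgevec,
    state_tangent s (nu s *m x, eta s *m x).

Variable mstar : edgevec.

Definition control_field (s : state) : state :=
  (nu s *m (mstar - s.2), eta s *m (mstar - s.2)).

(* z solves the initial value problem on [0, T), T possibly infinite; at t = 0
   the equation holds one-sidedly by continuity when the field is continuous. *)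
Definition solution_upto (s0 : state) (T : \bar R) (z : R -> state) : Prop :=
  [/\ z 0 = s0,
      forall t : R, 0 <= t -> (t%:E < T)%E -> D (z t),
      {within [set t : R | 0 <= t /\ (t%:E < T)%E], continuous z} &
      forall t : R, 0 < t -> (t%:E < T)%E ->
        is_derive t (1 : R) z (control_field (z t))].

(* z is the solution: it is defined for all t >= 0, and every solution on an
   initial interval [0, T) coincides with it there. *)
Definition the_solution (s0 : state) (z : R -> state) : Prop :=
  solution_upto s0 +oo%E z /\
  forall (T : \bar R) (w : R -> state), solution_upto s0 T w ->
    forall t : R, 0 <= t -> (t%:E < T)%E -> w t = z t.

Variable pstar : config.

Definition locally_convergent : Prop :=
  exists2 U, nbhd_in state_space (pstar, mstar) U &
    forall s0, U s0 -> exists z q,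
      [/\ the_solution s0 z, congruent pstar q, state_space (q, mstar) &
          z t @[t --> +oo] --> (q, mstar)].

Definition edge_exp_stable : Prop :=
  exists2 U, nbhd_in state_space (pstar, mstar) U &
    exists C c : R, [/\ 0 < C, 0 < c &
      forall s0, U s0 -> exists2 z, the_solution s0 z &
        forall t : R, 0 <= t -> enorm (mstar - (z t).2) <= C * expR (- (c * t))].

Definition node_exp_stable : Prop :=
  exists2 U, nbhd_in state_space (pstar, mstar) U &
    exists K k : R, [/\ 0 < K, 0 < k &
      forall s0, U s0 -> exists2 z, the_solution s0 z &
        exists2 q, congruent pstar q &
          forall t : R, 0 <= t -> enorm (q - (z t).1) <= K * expR (- (k * t))].

End Controller.

Definition rational_on (V : set state) (f : state -> R) : Prop :=
  exists P Q : mpoly.mpoly (n * d + nedges G) R,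
    forall s, V s ->
      let x := fun i => col_mx s.1 s.2 i ord0 in
      mpoly.meval x Q != 0 /\ f s = mpoly.meval x P / mpoly.meval x Q.

Definition rational_mx_on (V : set state) (a b : nat)
    (A : state -> 'M[R]_(a, b)) : Prop :=
  forall i j, rational_on V (fun s => A s i j).

End Framework.

Definition posdef_on (R : realType) (k : nat) (A : 'M[R]_k) (L : set 'cV[R]_k) :
    Prop :=
  forall x, L x -> x != 0 -> 0 < inner x (A *m x).

Arguments distmap {R n d} G p.
Arguments rigidity_mx {R n d} G p.
Arguments max_rank R {n} d G.
Arguments regular_values R {n} d G.
Arguments regular_points R {n} d G.
Arguments locally_rigid {R n d} G p.
Arguments generically_rigid R {n} d G.
Arguments state_space R {n} d G.
Arguments state_tangent {R n d} G s.

(* Main.v *)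
Require Import Defs.
From mathcomp Require Import all_boot all_order all_algebra.
From mathcomp Require Import all_classical all_reals all_analysis.
From mathcomp Require Import ring lra.
From mathcomp Require mpoly.
Import Order.TTheory GRing.Theory Num.Theory.
Import numFieldNormedType.Exports.
Local Open Scope classical_set_scope.
Local Open Scope ring_scope.

(** Write [F] for the distance map, [R(p)] for the rigidity matrix and
    [x = mstar - F(p)] for the error. On the state space the edge vector is
    [F(p)], so the closed loop is an autonomous equation
    [p' = N(p) (mstar - F(p))] in the configuration alone, where
    [N(p) = nu(p, F(p))], and along it [x' = - eta x] with [eta = 2 R(p) N(p)].

    Decay of the error. Positive definiteness at the target only concerns the
    tangent space [Im R(pstar)], whereas [x] is a chord of the image of [F].
    Since [F] is quadratic, however, [F(p) - F(pstar) = 2 R(mid) (p - pstar)] holds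
    exactly with [mid = (p + pstar) / 2] ([distmap_midpoint]), so [x] lies in the
    image of [R(mid)]. The rank of [R] is maximal at [pstar] and lower
    semicontinuous, hence constant near [pstar], and the images of [R(mid)] vary
    continuously with [p]; coercivity of the form on [Im R(pstar)] therefore
    persists on [Im R(mid)] ([coercive_on_image], [err_coercive]). So
    [|x|^2] satisfies a linear differential inequality and decays
    exponentially ([err_decay]).

    Convergence of the configuration. The speed of [p] is at most a constant
    times [|x|], so the remaining path length decays exponentially as well
    ([flow_increment]). A trajectory that starts close to [pstar] is therefore
    trapped in a small ball ([flow_trapped]) and converges to some [q] with
    [F(q) = mstar] ([flow_limit]); local rigidity of [pstar] makes [q] congruent to
    [pstar].

    Existence and uniqueness of the solution come from Picard iteration
    ([ode_exists], [ode_unique]), applied to the field composed with the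
    truncation to a ball, which is globally Lipschitz; the trapping estimate
    shows that the truncation is never active.

    Finally, trajectories stay among the regular points because these form a
    neighborhood of [pstar] ([regular_points_open]): a chart of the image at one
    value serves all nearby values, and the rank condition on whole fibres is
    stable because the fibres are compact up to translating the connected
    components of the graph ([pinned_representative], [rank_near_fibre]). *)

Set Implicit Arguments.
Unset Strict Implicit.
Unset Printing Implicit Defensive.

(** * Euclidean and sup norms *)

Section Norms.
Variable R : realType.

Lemma ler_entry_norm (m n : nat) (x : 'M[R]_(m, n)) i j : `|x i j| <= `|x|.
Proof.
rewrite [leRHS]/Num.Def.normr/= mx_normrE.
exact: (le_bigmax _ (fun ij => `|x ij.1 ij.2|) (i, j)).
Qed.

Lemma mxnorm_le (m n : nat) (x : 'M[R]_(m, n)) (c : R) :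
  0 <= c -> (forall i j, `|x i j| <= c) -> `|x| <= c.
Proof.
move=> c0 h; rewrite [leLHS]/Num.Def.normr/= mx_normrE.
by apply: bigmax_le => // -[i j] _; exact: h.
Qed.

Lemma inner_ge0 (k : nat) (x : 'cV[R]_k) : 0 <= inner x x.
Proof. by apply: sumr_ge0 => i _; rewrite -expr2 sqr_ge0. Qed.

Lemma sqr_enorm (k : nat) (x : 'cV[R]_k) : enorm x ^+ 2 = inner x x.
Proof. by rewrite sqr_sqrtr // inner_ge0. Qed.

Lemma enorm_ge0 (k : nat) (x : 'cV[R]_k) : 0 <= enorm x.
Proof. exact: sqrtr_ge0. Qed.

Lemma ler_entry_enorm (k : nat) (x : 'cV[R]_k) i : `|x i ord0| <= enorm x.
Proof.
rewrite -ler_sqr ?nnegrE ?enorm_ge0 //.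
rewrite sqr_enorm /inner (bigD1 i) //= real_normK ?num_real // expr2 lerDl.
by apply: sumr_ge0 => j _; rewrite -expr2 sqr_ge0.
Qed.

Lemma inner_le_norm (k : nat) (x : 'cV[R]_k) (c : R) : 
  (forall i, `|x i ord0| <= c) -> inner x x <= k%:R * c ^+ 2.
Proof.
move=> h; apply: le_trans (_ : \sum_(i < k) c ^+ 2 <= _).
  apply: ler_sum => i _; rewrite -expr2 -real_normK ?num_real //.
  by rewrite lerXn2r ?nnegrE // (le_trans _ (h i)).
by rewrite sumr_const card_ord mulr_natl.
Qed.

Lemma enorm_le_norm (k : nat) (x : 'cV[R]_k) (c : R) : 0 <= c ->
  (forall i, `|x i ord0| <= c) -> enorm x <= k%:R * c.
Proof.
move=> c0 /inner_le_norm h.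
have kc : 0 <= k%:R * c :> R by rewrite mulr_ge0.
rewrite -[leRHS](ger0_norm kc) -[leRHS]sqrtr_sqr ler_wsqrtr //.
apply: (le_trans h); rewrite exprMn ler_wpM2r ?sqr_ge0 //.
by rewrite -natrX ler_nat; case: (k) => // k'; rewrite expnS expn1 leq_pmulr.
Qed.

End Norms.

(** * Mean value inequalities on the real line *)

Section Comparison.
Variable R : realType.
Implicit Types f phi : R -> R.

Lemma ge0_derive_le (g dg : R -> R) (a b : R) : a <= b ->
  {within `[a, b], continuous g} ->
  (forall t, a < t < b -> is_derive t (1 : R) g (dg t)) ->
  (forall t, a < t < b -> 0 <= dg t) -> g a <= g b.
Proof.
move=> ab cg Dg dg0; apply: (@ger0_derive1_le_cc R g a b) => //.
- by move=> x; rewrite in_itv /= => /Dg [].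
- move=> x; rewrite in_itv /= => /[dup] /dg0 + /Dg Dgx.
  by rewrite derive1E derive_val.
- by rewrite in_itv /= lexx ab.
- by rewrite in_itv /= lexx ab.
Qed.

(** Stands in for the estimate of an integral by an integral: a bound on a
    derivative by the derivative of [phi] bounds the increment by that of
    [phi]. *)
Lemma increment_le f phi (df dphi : R -> R) (a b : R) : a <= b ->
  {within `[a, b], continuous f} -> {within `[a, b], continuous phi} ->
  (forall t, a < t < b -> is_derive t (1 : R) f (df t)) ->
  (forall t, a < t < b -> is_derive t (1 : R) phi (dphi t)) ->
  (forall t, a < t < b -> `|df t| <= dphi t) ->
  `|f b - f a| <= phi b - phi a.
Proof.
move=> ab cf cphi Df Dphi le.
rewrite ler_norml; apply/andP; split.
- have := @ge0_derive_le (phi \+ f) (fun t => dphi t + df t) a b ab.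
  rewrite /= => /(_ _ _ _)/wrap[].
  + by move=> x; apply: continuousD; [exact: cphi|exact: cf].
  + by move=> t tab; apply: is_deriveD; [exact: Dphi|exact: Df].
  + by move=> t /le; rewrite ler_norml => /andP[+ _]; lra.
  + lra.
- have := @ge0_derive_le (phi \- f) (fun t => dphi t - df t) a b ab.
  rewrite /= => /(_ _ _ _)/wrap[].
  + by move=> x; apply: continuousB; [exact: cphi|exact: cf].
  + by move=> t tab; apply: is_deriveB; [exact: Dphi|exact: Df].
  + by move=> t /le; rewrite ler_norml => /andP[_ +]; lra.
  + lra.
Qed.

Lemma is_derive_scaled_expR (A k t : R) :
  is_derive t (1 : R) (fun t => A * expR (k * t)) (A * k * expR (k * t)).
Proof.
have -> : (fun t => A * expR (k * t)) = A *: (expR \o ( *%R k)).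
  by apply/funext.
have H : is_derive t (1:R) ( *%R k) k.
  by apply: is_derive_eq; rewrite /GRing.scale /=; ring.
apply: is_derive_eq; rewrite /GRing.scale /=; ring.
Qed.

Lemma continuous_scaled_expR (A k : R) : continuous (fun t => A * expR (k * t)).
Proof.
move=> t; apply: differentiable_continuous; apply/derivable1_diffP.
by case: (is_derive_scaled_expR A k t).
Qed.

Lemma expR_decay_lt (C c e : R) : 0 < c -> 0 < e ->
  exists2 t : R, 0 <= t & C * expR (- (c * t)) < e.
Proof.
move=> c0 e0; exists (`|C| / (e * c)).
  by rewrite divr_ge0 // mulr_ge0 // ltW.
set t := _ / _.
have ct : c * t = `|C| / e by rewrite /t invfM; field; rewrite !gt_eqF.
apply: le_lt_trans (_ : `|C| * expR (- (c * t)) < e).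
  by rewrite ler_wpM2r ?expR_ge0 // ler_norm.
rewrite expRN ct ltr_pdivrMr ?expR_gt0 //.
apply: lt_le_trans (_ : e * (1 + `|C| / e) <= _).
  by rewrite mulrDr mulr1 mulrCA divff ?gt_eqF // mulr1 ltrDr.
by rewrite ler_wpM2l ?expR_ge1Dx // ltW.
Qed.

Lemma expR_decay_eq0 (a C c : R) : 0 < c ->
  (forall t, 0 <= t -> `|a| <= C * expR (- (c * t))) -> a = 0.
Proof.
move=> c0 h; apply/eqP; rewrite -normr_le0 leNgt; apply/negP => a0.
have [t t0 lt] := expR_decay_lt C c0 a0.
by have := le_lt_trans (h t t0) lt; rewrite ltxx.
Qed.

(** Continuity argument: at the first time where [h] reaches [3 d / 4], all
    earlier values are below [d], so the hypothesis forces [h] down to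
    [d / 2] at that very time. *)
Lemma bootstrap (h : R -> R) (d T : R) :
  0 < d -> {within `[0, T], continuous h} ->
  (forall t, 0 <= t <= T -> (forall s, 0 <= s <= t -> h s <= d) -> h t <= d / 2) ->
  h 0 <= d / 2 ->
  forall t, 0 <= t <= T -> h t <= d / 2.
Proof.
move=> d0 ch step h0 t tT; apply: (step) => // s st.
have sT : 0 <= s <= T by lra.
rewrite leNgt; apply/negP => hs.
have chs : {within `[0, s], continuous h}.
  by apply: continuous_subspaceW ch; apply: subset_itvl; rewrite bnd_simp; lra.
have : closed (h @^-1` [set y | 3 / 4 * d <= y] : set (subspace `[0, s])).
  by apply: preimage_closed; last exact: closed_ge.
move/closed_subspaceP => [K cK KE].
have inK u : 0 <= u <= s -> K u <-> 3 / 4 * d <= h u.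
  move=> us; have uI : `[0, s]%classic u by rewrite /= in_itv.
  split=> [Ku|hu].
    by have : (K `&` [set` `[0, s]]) u by []; rewrite KE => -[].
  by have : (h @^-1` [set y | 3 / 4 * d <= y] `&` `[0, s]) u by []; rewrite -KE => -[].
have cA : compact (K `&` `[0, s]).
  apply: subclosed_compact (@segment_compact _ 0 s) _ => [|u []//].
  by apply: closedI => //; exact: interval_closed.
have As : (K `&` [set` `[0, s]]) s.
  by split; [apply/inK; lra|rewrite /= in_itv /=; lra].
have cid : {within K `&` [set` `[0, s]], continuous (id : R -> R)}.
  by apply: continuous_subspaceT => x; exact: cvg_id.
(* [u] is the first time in [0, s] at which [h] is at least [3 d / 4]. *)
have [u /set_mem[Ku]] := compact_EVT_min (ex_intro _ s As) cA cid.
rewrite /= in_itv /= => us umin.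
have before v : 0 <= v <= s -> 3 / 4 * d <= h v -> u <= v.
  move=> vs hv; apply: umin; rewrite inE; split; last by rewrite /= in_itv.
  exact/inK.
have hu : 3 / 4 * d <= h u by apply/inK.
have chu : {within `[0, u], continuous h}.
  by apply: continuous_subspaceW chs; apply: subset_itvl; rewrite bnd_simp; lra.
have [] := @IVT R h 0 u (3 / 4 * d) _ chu; first by lra.
  by rewrite min_l ?max_r; lra.
move=> c; rewrite in_itv /= => cu hc.
have uc : u = c.
  apply/eqP; rewrite eq_le; apply/andP; split; last by case/andP: cu.
  by apply: before; lra.
suff : h u <= d / 2 by rewrite uc hc; lra.
apply: step => [|v vu]; first by lra.
have [->|vneu] := eqVneq v u; first by rewrite uc hc; lra.
rewrite leNgt; apply/negP => dv.
have : u <= v by apply: before; lra.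
by move: vneu; rewrite neq_lt => /orP[]; lra.
Qed.

End Comparison.

(** * Limits and primitives *)

Section Limits.
Variable R : realType.

(** Completeness, in a form that serves sequences as well as functions of time:
    the intervals of center [a i] and radius [e i] meet pairwise, hence have a
    common point. *)
Lemma common_limit (I : Type) (i0 : I) (a e : I -> R) :
  (forall i j, `|a i - a j| <= e i + e j) ->
  exists l, forall i, `|a i - l| <= e i.
Proof.
move=> h; exists (sup (range (fun i => a i - e i))) => i.
have ub j : ubound (range (fun i => a i - e i)) (a j + e j).
  move=> _ [k _ <-]; have := h k j; rewrite ler_norml => /andP[_]; lra.
have le j : a j - e j <= sup (range (fun i => a i - e i)).
  by apply: ub_le_sup; [exists (a j + e j); exact: ub|exists j].
have ge j : sup (range (fun i => a i - e i)) <= a j + e j.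
  by apply: ge_sup; [exists (a i0 - e i0); exists i0|exact: ub].
by have := le i; have := ge i; rewrite ler_norml; lra.
Qed.

Lemma halvings_le0 (a B : R) : (forall k, a <= B / 2 ^+ k) -> a <= 0.
Proof.
move=> h; rewrite leNgt; apply/negP => a0.
have B0 : 0 <= B by have := h 0%N; rewrite expr0 divr1; lra.
have := h (Num.bound (B / a)).
apply/negP; rewrite -ltNge ltr_pdivrMr ?exprn_gt0 //.
rewrite mulrC -ltr_pdivrMr //.
apply: lt_le_trans (archi_boundP _) _; first by rewrite divr_ge0 // ltW.
by rewrite -natrX ler_nat ltnW // ltn_expl.
Qed.

Lemma lipschitz_continuous (f : R -> R) (K : R) :
  (forall s t, `|f t - f s| <= K * `|t - s|) -> continuous f.
Proof.
move=> h x; apply/cvgrPdist_le => e e0.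
have K1 : 0 < `|K| + 1 by rewrite ltr_wpDl.
near=> t.
apply: le_trans (h t x) _.
apply: le_trans (_ : (`|K| + 1) * `|x - t| <= _).
  by rewrite ler_wpM2r // (le_trans (ler_norm K)) // lerDl.
rewrite mulrC -ler_pdivlMr //.
near: t; apply: cvgr_dist_le; last by rewrite divr_gt0.
exact: cvg_id.
Unshelve. all: by end_near. Qed.

(** Integrating from -1 rather than 0 makes the primitive differentiable, in the
    two-sided sense, at the initial time 0. *)
Definition primitive (f : R -> R) (t : R) : R :=
  \int[@lebesgue_measure R]_(s in [set` `[-1, t]]) f s -
  \int[@lebesgue_measure R]_(s in [set` `[-1, 0]]) f s.

Lemma primitive0 f : primitive f 0 = 0.
Proof. by rewrite /primitive subrr. Qed.

Lemma is_derive_primitive (f : R -> R) (t : R) : continuous f -> -1 < t ->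
  is_derive t (1 : R) (primitive f) (f t).
Proof.
move=> cf t1.
have fi : (@lebesgue_measure R).-integrable `[-1, t + 1] (EFin \o f).
  apply: continuous_compact_integrable; first exact: segment_compact.
  exact: continuous_subspaceT.
have tlt : t < t + 1 by rewrite ltrDl.
have [D E] := @continuous_FTC1_closed R f (-1) t (t + 1) tlt fi t1 (cf t).
have -> : primitive f =
    (fun x => \int[@lebesgue_measure R]_(s in [set` `[-1, x]]) f s) \+
    cst (- \int[@lebesgue_measure R]_(s in [set` `[-1, 0]]) f s) by [].
rewrite -[X in is_derive _ _ _ X]addr0 -[X in X + 0]E derive1E.
by apply: is_deriveD; exact: derivableP.
Qed.

End Limits.

(** * Picard iteration *)

Section ODE.
Variables (R : realType) (N : nat).
Local Notation vec := 'cV[R]_N.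

(** Solutions are handled coordinate by coordinate: the mean value inequality
    for real functions then suffices. *)
Definition ode_on (g : vec -> vec) (T : R) (x : R -> vec) : Prop :=
  forall i, {within `[0, T], continuous (fun t => x t i ord0)} /\
    forall t, 0 < t < T ->
      is_derive t (1 : R) (fun t => x t i ord0) (g (x t) i ord0).

Lemma ode_onW g (S T : R) x : S <= T -> ode_on g T x -> ode_on g S x.
Proof.
move=> ST h i; have [c D] := h i; split.
  by apply: continuous_subspaceW c; apply: subset_itvl; rewrite bnd_simp.
by move=> t tS; apply: D; lra.
Qed.

(** With distances weighted by [expR (- (2 * L * t))], integrating a field of
    Lipschitz constant [L] halves them. The weight makes Picard iteration a
    contraction on all of [0, +oo[ at once. *)
Lemma increment_halving (h dh : R -> vec) (L A T : R) :
  0 < L -> 0 <= A -> 0 <= T -> h 0 = 0 ->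
  (forall i, {within `[0, T], continuous (fun t => h t i ord0)}) ->
  (forall i t, 0 < t < T ->
    is_derive t (1 : R) (fun t => h t i ord0) (dh t i ord0)) ->
  (forall t, 0 < t < T -> `|dh t| <= L * (A * expR (2 * L * t))) ->
  `|h T| <= A / 2 * expR (2 * L * T).
Proof.
move=> L0 A0 T0 h0 ch Dh le.
apply: mxnorm_le => [|i j]; first by rewrite mulr_ge0 ?expR_ge0 ?divr_ge0.
rewrite (ord1 j).
have H : `|h T i ord0 - h 0 i ord0| <=
    A / 2 * expR (2 * L * T) - A / 2 * expR (2 * L * 0).
  apply: (@increment_le R (fun t => h t i ord0)
    (fun t => A / 2 * expR (2 * L * t)) (fun t => dh t i ord0)
    (fun t => A / 2 * (2 * L) * expR (2 * L * t))) => //.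
  - by apply: continuous_subspaceT => t; exact: continuous_scaled_expR.
  - by move=> t _; exact: is_derive_scaled_expR.
  - move=> t tT; apply: le_trans (ler_entry_norm _ _ _) _.
    apply: le_trans (le t tT) _.
    by rewrite le_eqVlt; apply/orP; left; apply/eqP; field.
move: H; rewrite h0 mxE subr0 => /le_trans; apply.
by rewrite gerBl mulr_ge0 ?expR_ge0 ?divr_ge0.
Qed.

Lemma entry_sub (x y : vec) i : (x - y) i ord0 = x i ord0 - y i ord0.
Proof. by rewrite !mxE. Qed.

Lemma entryB (u w : R -> vec) i : (fun t => (u t - w t) i ord0) =
  (fun t => u t i ord0) \- (fun t => w t i ord0).
Proof. by apply/funext => t; rewrite !mxE. Qed.

(** Starting from the crude bound [C], each use of the equation halves the
    weighted distance between the two solutions. *)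
Lemma ode_unique g (L C T : R) (u w : R -> vec) :
  0 < L -> 0 <= T -> ode_on g T u -> ode_on g T w -> u 0 = w 0 ->
  (forall t, 0 <= t <= T -> `|u t - w t| <= C) ->
  (forall t, 0 <= t <= T -> `|g (u t) - g (w t)| <= L * `|u t - w t|) ->
  u T = w T.
Proof.
move=> L0 T0 hu hw uw0 bd lip.
have C0 : 0 <= C by apply: le_trans (bd 0 _) => //; lra.
have key k : forall t, 0 <= t <= T ->
    `|u t - w t| <= C / 2 ^+ k * expR (2 * L * t).
  elim: k => [|k IH] t tT.
    rewrite expr0 divr1 (le_trans (bd t tT)) // ler_peMr //.
    by rewrite -expR0 ler_expR !mulr_ge0 ?(ltW L0) //; case/andP: tT.
  rewrite exprS invfM mulrA.
  have -> : C / 2 / 2 ^+ k = C / 2 ^+ k / 2 by rewrite mulrAC.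
  have tT' : t <= T by lra.
  apply: (@increment_halving (fun s => u s - w s) (fun s => g (u s) - g (w s)) L)
    => //.
  - by rewrite divr_ge0 // exprn_ge0.
  - by lra.
  - by rewrite uw0 subrr.
  - move=> i; have [cu _] := ode_onW tT' hu i; have [cw _] := ode_onW tT' hw i.
    rewrite entryB => x.
    by apply: continuousB; [exact: cu|exact: cw].
  - move=> i s sT; have [_ /(_ s sT) du] := ode_onW tT' hu i.
    have [_ /(_ s sT) dw] := ode_onW tT' hw i.
    by rewrite entryB !mxE; exact: is_deriveB.
  - move=> s st; have sT : 0 <= s <= T by lra.
    by apply: le_trans (lip s sT) _; rewrite ler_wpM2l ?IH // ltW.
apply/eqP; rewrite -subr_eq0 -normr_le0.
apply: (@halvings_le0 _ _ (C * expR (2 * L * T))) => k.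
by rewrite mulrAC; apply: key; lra.
Qed.

Section Picard.
Variables (g : vec -> vec) (x0 : vec) (M L : R).
Hypothesis g_bounded : forall x, `|g x| <= M.
Hypothesis g_lipschitz : forall x y, `|g x - g y| <= L * `|x - y|.
Hypothesis L_gt0 : 0 < L.

Let M_ge0 : 0 <= M. Proof. exact: le_trans (g_bounded 0). Qed.

(** The field is frozen at time 0 for negative times, which keeps the
    integrand continuous on the whole line. *)
Definition picard (x : R -> vec) (t : R) : vec :=
  x0 + \col_i primitive (fun s : R => g (x (Num.max s 0)) i ord0) t.

Let speed_limited (x : R -> vec) :=
  forall s t : R, 0 <= s -> 0 <= t -> `|x t - x s| <= M * `|t - s|.

Let picard_field_continuous x i : speed_limited x ->
  continuous (fun s : R => g (x (Num.max s 0)) i ord0).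
Proof.
move=> hx; apply: (@lipschitz_continuous _ _ (L * M)) => s t.
have := ler_entry_norm (g (x (Num.max t 0)) - g (x (Num.max s 0))) i ord0.
rewrite !mxE => /le_trans; apply.
apply: le_trans (g_lipschitz _ _) _; rewrite -mulrA ler_wpM2l ?(ltW L_gt0) //.
apply: le_trans (hx _ _ _ _) _; rewrite ?le_max ?lexx ?orbT //.
rewrite ler_wpM2l //.
have := ler_norm (t - s); have := ler_norm (s - t); rewrite distrC => le1 le2.
have [t0|t0] := leP 0 t; have [s0|s0] := leP 0 s => //.
- by rewrite subr0 ger0_norm //; lra.
- by rewrite sub0r normrN ger0_norm //; lra.
- by rewrite subrr normr0.
Qed.

Let picard0 x : picard x 0 = x0.
Proof. by apply/matrixP => i j; rewrite !mxE primitive0 addr0 (ord1 j). Qed.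

Let is_derive_picard x i (t : R) : speed_limited x -> -1 < t ->
  is_derive t (1 : R) (fun t => picard x t i ord0)
    (g (x (Num.max t 0)) i ord0).
Proof.
move=> hx t1.
rewrite (_ : (fun _ => _) = cst (x0 i ord0) \+
  primitive (fun s : R => g (x (Num.max s 0)) i ord0)); last first.
  by apply/funext => s; rewrite !mxE.
rewrite -[X in is_derive _ _ _ X]add0r.
apply: is_deriveD.
by apply: is_derive_primitive => //; exact: picard_field_continuous.
Qed.

Let picard_continuous_at x i (t : R) : speed_limited x -> -1 < t ->
  {for t, continuous (fun t => picard x t i ord0)}.
Proof.
move=> hx t1; apply: differentiable_continuous; apply/derivable1_diffP.
by case: (is_derive_picard i hx t1).
Qed.

Let picard_continuous x i (s t : R) : speed_limited x -> 0 <= s ->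
  {within `[s, t], continuous (fun t => picard x t i ord0)}.
Proof.
move=> hx s0; apply: continuous_in_subspaceT => r.
rewrite inE /= in_itv /= => /andP[sr _].
by apply: picard_continuous_at => //; lra.
Qed.

Let picard_speed_limited x : speed_limited x -> speed_limited (picard x).
Proof.
move=> hx.
suff h s t : 0 <= s <= t -> `|picard x t - picard x s| <= M * (t - s).
  move=> s t s0 t0; have [st|ts] := leP s t.
    by rewrite (le_trans (h s t _)) ?s0 // ger0_norm ?lexx // subr_ge0.
  rewrite distrC (distrC t) (le_trans (h t s _)) ?t0 ?(ltW ts) //.
  by rewrite ger0_norm // subr_ge0 ltW.
move=> st; apply: mxnorm_le => [|i j]; first by rewrite mulr_ge0 //; lra.
rewrite (ord1 j) [X in `|X|]mxE [X in _ + X]mxE mulrBr.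
apply: (@increment_le R (fun t => picard x t i ord0) (fun t => M * t)
  (fun t : R => g (x (Num.max t 0)) i ord0) (fun=> M)).
- by lra.
- by apply: picard_continuous => //; lra.
- by apply: continuous_subspaceT => r; apply: mulrl_continuous.
- by move=> r rs; apply: is_derive_picard => //; lra.
- move=> r _; apply: is_derive_eq; rewrite /GRing.scale /=; ring.
- by move=> r _; exact: le_trans (ler_entry_norm _ _ _) (g_bounded _).
Qed.

Let picard_contract x y (A t : R) : speed_limited x -> speed_limited y ->
  0 <= A -> 0 <= t ->
  (forall s, 0 <= s -> `|x s - y s| <= A * expR (2 * L * s)) ->
  `|picard x t - picard y t| <= A / 2 * expR (2 * L * t).
Proof.
move=> hx hy A0 t0 le.
apply: (@increment_halving (fun s => picard x s - picard y s)
  (fun s : R => g (x (Num.max s 0)) - g (y (Num.max s 0)))) => //.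
- by rewrite !picard0 subrr.
- by move=> i; rewrite entryB => s; apply: continuousB; apply: picard_continuous.
- move=> i s st; rewrite entryB entry_sub.
  by apply: is_deriveB; apply: is_derive_picard => //; lra.
- move=> s st; rewrite max_l; last by lra.
  apply: le_trans (g_lipschitz _ _) _.
  by rewrite ler_wpM2l ?(ltW L_gt0) //; apply: le; lra.
Qed.

Let iterate k := iter k picard (cst x0).

Let iterate_speed_limited k : speed_limited (iterate k).
Proof.
elim: k => [s t _ _|k IH]; last exact: picard_speed_limited.
by rewrite /iterate /= subrr normr0 mulr_ge0.
Qed.

Let C := M / (2 * L).
Let C_ge0 : 0 <= C. Proof. by rewrite divr_ge0 // mulr_ge0 // ltW. Qed.

Let iterate_step k (t : R) : 0 <= t ->
  `|iterate k.+1 t - iterate k t| <= C / 2 ^+ k * expR (2 * L * t).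
Proof.
elim: k t => [|k IH] t t0.
  have := picard_speed_limited (iterate_speed_limited 0) (lexx 0) t0.
  rewrite picard0 subr0 (ger0_norm t0) => /le_trans; apply.
  rewrite expr0 divr1.
  apply: le_trans (_ : C * (2 * L * t) <= _).
    by rewrite le_eqVlt; apply/orP; left; apply/eqP; rewrite /C; field; rewrite gt_eqF.
  rewrite ler_wpM2l // (le_trans _ (expR_ge1Dx _)) //; lra.
have -> : C / 2 ^+ k.+1 = C / 2 ^+ k / 2 by rewrite exprSr invfM mulrA.
apply: (picard_contract (iterate_speed_limited k.+1) (iterate_speed_limited k))
  => //.
by rewrite divr_ge0 ?exprn_ge0.
Qed.

Let iterate_dist k l (t : R) : 0 <= t ->
  `|iterate k t - iterate (k + l) t| <=
  (2 * C / 2 ^+ k - 2 * C / 2 ^+ (k + l)) * expR (2 * L * t).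
Proof.
move=> t0; elim: l => [|l IH]; first by rewrite addn0 !subrr normr0 mul0r.
apply: le_trans (ler_distD (iterate (k + l) t) _ _) _.
apply: le_trans (lerD IH _) _.
  by rewrite distrC addnS; exact: iterate_step.
rewrite -mulrDl ler_wpM2r ?expR_ge0 // addnS exprS invfM.
rewrite le_eqVlt; apply/orP; left; apply/eqP; field.
by rewrite !expf_neq0.
Qed.

(** The iterates converge geometrically in the weighted distance. They all have
    speed at most [M], hence so does their limit [x]; this makes the field
    continuous along [x], so that one more Picard step is defined and
    reproduces [x] as a differentiable function. *)
Theorem ode_exists : exists x, [/\ x 0 = x0,
  forall i (t : R), 0 <= t -> {for t, continuous (fun t => x t i ord0)} &
  forall T, ode_on g T x].
Proof.
have lim t : exists l, 0 <= t ->
    forall k, `|iterate k t - l| <= 2 * C / 2 ^+ k * expR (2 * L * t).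
  have [t0|t0] := leP 0 t; last by exists 0; lra.
  pose e k := 2 * C / 2 ^+ k * expR (2 * L * t).
  have e0 k : 0 <= e k.
    apply: mulr_ge0 (expR_ge0 _); apply: divr_ge0; last exact: exprn_ge0.
    exact: mulr_ge0.
  have d k l : `|iterate k t - iterate l t| <= e k + e l.
    wlog kl : k l / (k <= l)%N => [H|].
      have [kl|/ltnW lk] := leqP k l; first exact: H.
      by rewrite distrC (addrC (e k)); exact: H.
    rewrite -(subnKC kl); apply: le_trans (iterate_dist _ _ t0) _.
    by rewrite mulrBl lerD2l -subr_ge0 opprK addr_ge0 // e0.
  have coord i : exists l, forall k, `|iterate k t i ord0 - l| <= e k.
    apply: (@common_limit _ nat 0%N) => k l.
    have := ler_entry_norm (iterate k t - iterate l t) i ord0.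
    by rewrite !mxE => /le_trans; apply.
  have [l hl] := choice coord.
  exists (\col_i l i) => _ k; apply: mxnorm_le => [|i j]; first exact: e0.
  by rewrite (ord1 j) !mxE; exact: hl.
have [x xlim] := choice lim.
have hx : speed_limited x.
  move=> s t s0 t0; rewrite -subr_le0.
  apply: (@halvings_le0 _ _ (2 * C * expR (2 * L * t) + 2 * C * expR (2 * L * s))) => k.
  rewrite mulrDl lerBlDr.
  apply: le_trans (ler_distD (iterate k t) _ _) _.
  have := iterate_speed_limited k s0 t0.
  have := ler_distD (iterate k s) (iterate k t) (x s).
  have := xlim _ s0 k; have := xlim _ t0 k; rewrite (distrC (x t)).
  rewrite !(mulrAC _ (expR _)); lra.
have fix_x t : 0 <= t -> picard x t = x t.
  move=> t0; apply/eqP; rewrite -subr_eq0 -normr_le0.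
  apply: (@halvings_le0 _ _ (2 * C * expR (2 * L * t))) => k.
  apply: le_trans (ler_distD (iterate k.+1 t) _ _) _.
  have e0 : 0 <= 2 * C / 2 ^+ k.
    by apply: divr_ge0; [exact: mulr_ge0|exact: exprn_ge0].
  have := picard_contract (iterate_speed_limited k) hx e0 t0 (fun s s0 => xlim s s0 k).
  have := xlim t t0 k.+1; rewrite distrC => le1 le2.
  apply: le_trans (lerD le2 le1) _.
  rewrite exprS invfM le_eqVlt; apply/orP; left; apply/eqP; field.
  by rewrite expf_neq0.
exists (picard x); split => [|i t t0|T i]; first exact: picard0.
  by apply: picard_continuous_at => //; lra.
split; first exact: picard_continuous.
move=> t tT; have t0 : 0 <= t by lra.
by have := @is_derive_picard x i t hx; rewrite max_l // fix_x //; apply; lra.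
Qed.

End Picard.
End ODE.

(** * Functions that are Lipschitz near a point *)

Section LocLip.
Variables (R : realType) (V : normedModType R) (x0 : V).
Implicit Types f g : V -> R.

(** This class is stable under the field operations, so it contains the
    rational functions without pole at [x0], and it provides at once the
    Lipschitz constants of the existence theorem, local bounds, and
    perturbation estimates. *)
Definition loc_lip f : Prop := exists K d, [/\ 0 <= K, 0 < d &
  forall x y, `|x - x0| <= d -> `|y - x0| <= d -> `|f x - f y| <= K * `|x - y|].

Lemma loc_lip_close f e : loc_lip f -> 0 < e ->
  exists2 d, 0 < d & forall x, `|x - x0| <= d -> `|f x - f x0| <= e.
Proof.
move=> [K [d [K0 d0 h]]] e0; have K1 : 0 < K + 1 by lra.
exists (Num.min d (e / (K + 1))); first by rewrite lt_min d0 divr_gt0.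
move=> x; rewrite le_min => /andP[xd xe].
apply: le_trans (h _ _ xd _) _; first by rewrite subrr normr0 ltW.
rewrite (le_trans (ler_wpM2l K0 xe)) // mulrA ler_pdivrMr // mulrC.
by rewrite ler_wpM2l ?lerDl // ltW.
Qed.

Lemma loc_lip_common (I : finType) (F : I -> V -> R) :
  (forall i, loc_lip (F i)) ->
  exists K d, [/\ 0 <= K, 0 < d &
    forall i x y, `|x - x0| <= d -> `|y - x0| <= d ->
      `|F i x - F i y| <= K * `|x - y|].
Proof.
move=> /choice[K /choice[d h]].
exists (\sum_i K i), (\big[Num.min/1]_i d i); split.
- by apply: sumr_ge0 => i _; case: (h i).
- by apply: lt_bigmin => // i _; case: (h i).
move=> i x y xd yd; have [_ _ hi] := h i.
have dle : \big[Num.min/1]_i d i <= d i by exact: bigmin_le.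
apply: le_trans (hi _ _ (le_trans xd dle) (le_trans yd dle)) _.
rewrite ler_wpM2r // (bigD1 i) //= lerDl.
by apply: sumr_ge0 => j _; case: (h j).
Qed.

Lemma loc_lip_bounded f : loc_lip f ->
  exists B d, [/\ 0 <= B, 0 < d & forall x, `|x - x0| <= d -> `|f x| <= B].
Proof.
move=> /loc_lip_close/(_ ltr01)[d d0 h]; exists (`|f x0| + 1), d; split=> //.
move=> x /h; have := ler_normD (f x - f x0) (f x0); rewrite subrK; lra.
Qed.

Lemma loc_lip_cst (c : R) : loc_lip (fun=> c).
Proof. by exists 0, 1; split => // x y _ _; rewrite subrr normr0 mul0r. Qed.

Lemma loc_lip_near f g d : 0 < d ->
  (forall x, `|x - x0| <= d -> g x = f x) -> loc_lip f -> loc_lip g.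
Proof.
move=> d0 fg [K [d' [K0 d'0 h]]]; exists K, (Num.min d d'); split => //.
  by rewrite lt_min d0.
move=> x y; rewrite !le_min => /andP[xd xd'] /andP[yd yd'].
by rewrite !fg //; exact: h.
Qed.

Lemma loc_lipD f g : loc_lip f -> loc_lip g -> loc_lip (fun x => f x + g x).
Proof.
move=> [K [d [K0 d0 hf]]] [L [e [L0 e0 hg]]]; exists (K + L), (Num.min d e).
split; [by rewrite addr_ge0|by rewrite lt_min d0|].
move=> x y; rewrite !le_min => /andP[xd xe] /andP[yd ye].
rewrite opprD addrACA mulrDl (le_trans (ler_normD _ _)) //.
by rewrite lerD ?hf ?hg.
Qed.

Lemma loc_lipM f g : loc_lip f -> loc_lip g -> loc_lip (fun x => f x * g x).
Proof.
move=> lf lg.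
have [A [a [A0 a0 bf]]] := loc_lip_bounded lf.
have [B [b [B0 b0 bg]]] := loc_lip_bounded lg.
have [K [d [K0 d0 hf]]] := lf; have [L [e [L0 e0 hg]]] := lg.
exists (A * L + B * K), (Num.min (Num.min a b) (Num.min d e)).
split; [by rewrite addr_ge0 ?mulr_ge0|by rewrite !lt_min a0 b0 d0|].
move=> x y; rewrite !le_min.
move=> /andP[/andP[xa xb] /andP[xd xe]] /andP[/andP[ya yb] /andP[yd ye]].
have -> : f x * g x - f y * g y = f x * (g x - g y) + g y * (f x - f y).
  by ring.
rewrite mulrDl -!mulrA (le_trans (ler_normD _ _)) // !normrM.
by rewrite lerD // ler_pM ?bf ?bg ?hf ?hg.
Qed.

Lemma loc_lipN f : loc_lip f -> loc_lip (fun x => - f x).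
Proof.
move=> [K [d [K0 d0 h]]]; exists K, d; split => // x y xd yd.
by rewrite -opprD normrN; exact: h.
Qed.

Lemma loc_lipV f : f x0 != 0 -> loc_lip f -> loc_lip (fun x => (f x)^-1).
Proof.
move=> f0 lf; have F0 : 0 < `|f x0| by rewrite normr_gt0.
have [a a0 near0] := loc_lip_close lf (divr_gt0 F0 (ltr0n R 2)).
have {}near0 x : `|x - x0| <= a -> `|f x0| / 2 <= `|f x|.
  by move=> /near0; have := ler_normB (f x) (f x - f x0); rewrite opprB addrC subrK; lra.
have [K [d [K0 d0 h]]] := lf.
exists (K / (`|f x0| / 2) ^+ 2), (Num.min a d); split.
- by rewrite divr_ge0 ?exprn_ge0 ?divr_ge0.
- by rewrite lt_min a0.
move=> x y; rewrite !le_min => /andP[xa xd] /andP[ya yd].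
have fx := near0 _ xa; have fy := near0 _ ya.
have fx0 : f x != 0 by rewrite -normr_gt0; lra.
have fy0 : f y != 0 by rewrite -normr_gt0; lra.
have -> : (f x)^-1 - (f y)^-1 = (f y - f x) / (f x * f y).
  by field; rewrite fx0 fy0.
rewrite normrM normfV normrM mulrAC ler_pM ?invr_ge0 ?mulr_ge0 //.
  by rewrite distrC h.
rewrite lef_pV2 ?posrE ?mulr_gt0 ?normr_gt0 ?exprn_gt0 ?divr_gt0 //.
by rewrite expr2 ler_pM // divr_ge0.
Qed.

Lemma loc_lip_sum (I : Type) (s : seq I) (P : pred I) (F : I -> V -> R) :
  (forall i, loc_lip (F i)) -> loc_lip (fun x => \sum_(i <- s | P i) F i x).
Proof.
move=> h; elim: s => [|i s IH].
  by under eq_fun do rewrite big_nil; exact: loc_lip_cst.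
under eq_fun do rewrite big_cons; case: (P i) => //.
exact: loc_lipD.
Qed.

Lemma loc_lip_prod (I : Type) (s : seq I) (F : I -> V -> R) :
  (forall i, loc_lip (F i)) -> loc_lip (fun x => \prod_(i <- s) F i x).
Proof.
move=> h; elim: s => [|i s IH].
  by under eq_fun do rewrite big_nil; exact: loc_lip_cst.
under eq_fun do rewrite big_cons.
exact: loc_lipM.
Qed.

Lemma loc_lipX f n : loc_lip f -> loc_lip (fun x => f x ^+ n).
Proof.
move=> lf; elim: n => [|n IH].
  by under eq_fun do rewrite expr0; exact: loc_lip_cst.
under eq_fun do rewrite exprS.
exact: loc_lipM.
Qed.

Lemma loc_lip_meval n (p : mpoly.mpoly n R) (v : V -> 'I_n -> R) :
  (forall i, loc_lip (fun x => v x i)) -> loc_lip (fun x => mpoly.meval (v x) p).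
Proof.
move=> h; under eq_fun do rewrite mpoly.mevalE.
apply: loc_lip_sum => m; apply: loc_lipM; first exact: loc_lip_cst.
by apply: loc_lip_prod => i; exact: loc_lipX.
Qed.

(** The mean value formula for the distance map evaluates the rigidity matrix at
    the midpoint with the target configuration. *)
Lemma loc_lip_midpoint f : loc_lip f -> loc_lip (fun x => f (2^-1 *: (x + x0))).
Proof.
have half x y : 2^-1 *: (x + x0) - 2^-1 *: (y + x0) = 2^-1 *: (x - y) :> V.
  by rewrite -scalerBr opprD addrACA subrr addr0.
have lehalf x y : `|2^-1 *: (x - y) : V| <= `|x - y|.
  rewrite normrZ ger0_norm ?invr_ge0 //; have := normr_ge0 (x - y); lra.
have fix0 : x0 = 2^-1 *: (x0 + x0).
  by rewrite scalerDr -scalerDl -[LHS]scale1r; congr (_ *: _); field.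
move=> [K [d [K0 d0 h]]]; exists K, d; split => // x y xd yd.
apply: le_trans (h _ _ _ _) _.
- by rewrite {2}fix0 half (le_trans (lehalf _ _)).
- by rewrite {2}fix0 half (le_trans (lehalf _ _)).
- by rewrite half ler_wpM2l.
Qed.

End LocLip.

Lemma loc_lip_coord (R : realType) (n : nat) (x0 : 'cV[R]_n) i :
  loc_lip x0 (fun x => x i ord0).
Proof.
exists 1, 1; split => // x y _ _; rewrite mul1r.
by have := ler_entry_norm (x - y) i ord0; rewrite !mxE.
Qed.

(** * Quadratic forms and rank under perturbation *)

Section Forms.
Variable R : realType.

Lemma inner_mxE k (x y : 'cV[R]_k) : inner x y = (x^T *m y) ord0 ord0.
Proof. by rewrite mxE; apply: eq_bigr => i _; rewrite mxE. Qed.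

Lemma inner_mulmx k l (A : 'M[R]_(k, l)) y z :
  inner (A *m y) z = inner y (A^T *m z).
Proof. by rewrite !inner_mxE trmx_mul mulmxA. Qed.

(** From the entrywise bound and [2 |a b| <= a^2 + b^2]. *)
Lemma qform_bound k (M : 'M[R]_k) e (y : 'cV[R]_k) :
  (forall i j, `|M i j| <= e) -> `|inner y (M *m y)| <= e * k%:R * inner y y.
Proof.
move=> h.
have -> : inner y (M *m y) = \sum_i \sum_j y i ord0 * M i j * y j ord0.
  apply: eq_bigr => i _; rewrite mxE mulr_sumr.
  by apply: eq_bigr => j _; rewrite mulrA.
apply: le_trans (ler_norm_sum _ _ _) _.
apply: le_trans (_ : \sum_(i < k) \sum_(j < k)
    (e / 2 * (y i ord0 ^+ 2) + e / 2 * (y j ord0 ^+ 2)) <= _).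
  apply: ler_sum => i _; apply: le_trans (ler_norm_sum _ _ _) _.
  apply: ler_sum => j _; rewrite !normrM -mulrDr mulrAC.
  have := h i j; have := normr_ge0 (M i j).
  rewrite -(real_normK (num_real (y i ord0))) -(real_normK (num_real (y j ord0))).
  have := normr_ge0 (y i ord0); have := normr_ge0 (y j ord0).
  move: (`|y i ord0|) (`|y j ord0|) (`|M i j|) => a b c b0 a0 c0 ce.
  apply: le_trans (_ : a * b * e <= _); first by rewrite ler_wpM2l // mulr_ge0.
  have : 0 <= e * (a - b) ^+ 2 by rewrite mulr_ge0 ?sqr_ge0 // (le_trans c0).
  nra.
under eq_bigr do rewrite big_split /= sumr_const card_ord -!mulr_sumr.
rewrite big_split /= sumr_const card_ord sumrMnl -mulr_sumr.
have -> : inner y y = \sum_i y i ord0 ^+ 2.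
  by apply: eq_bigr => i _; rewrite expr2.
rewrite -(mulr_natr (e / 2 * _)) le_eqVlt; apply/orP; left; apply/eqP; by field.
Qed.

End Forms.

Section Semicontinuity.
Variables (R : realType) (V : normedModType R) (x0 : V).

Definition loc_lip_mx m n (A : V -> 'M[R]_(m, n)) :=
  forall i j, loc_lip x0 (fun x => A x i j).

Lemma loc_lip_mx_cst m n (A : 'M[R]_(m, n)) : loc_lip_mx (fun=> A).
Proof. by move=> i j; exact: loc_lip_cst. Qed.

Lemma loc_lip_mx_tr m n (A : V -> 'M[R]_(m, n)) :
  loc_lip_mx A -> loc_lip_mx (fun x => (A x)^T).
Proof. by move=> h i j; under eq_fun do rewrite mxE; exact: h. Qed.

Lemma loc_lip_mxM m n p (A : V -> 'M[R]_(m, n)) (B : V -> 'M[R]_(n, p)) :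
  loc_lip_mx A -> loc_lip_mx B -> loc_lip_mx (fun x => A x *m B x).
Proof.
move=> hA hB i j; under eq_fun do rewrite mxE.
by apply: loc_lip_sum => l; exact: loc_lipM.
Qed.

Lemma loc_lip_mxZ m n (c : R) (A : V -> 'M[R]_(m, n)) :
  loc_lip_mx A -> loc_lip_mx (fun x => c *: A x).
Proof.
move=> hA i j; under eq_fun do rewrite mxE.
by apply: loc_lipM => //; exact: loc_lip_cst.
Qed.

Lemma loc_lip_mxB m n (A B : V -> 'M[R]_(m, n)) :
  loc_lip_mx A -> loc_lip_mx B -> loc_lip_mx (fun x => A x - B x).
Proof.
move=> hA hB i j; under eq_fun do rewrite !mxE.
by apply: loc_lipD => //; exact: loc_lipN.
Qed.

Lemma loc_lip_mx_lipschitz m n (A : V -> 'M[R]_(m, n)) : loc_lip_mx A ->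
  exists K d, [/\ 0 <= K, 0 < d & forall x y,
    `|x - x0| <= d -> `|y - x0| <= d -> `|A x - A y| <= K * `|x - y|].
Proof.
move=> hA; have [K [d [K0 d0 h]]] :=
  loc_lip_common (fun ij : 'I_m * 'I_n => hA ij.1 ij.2).
exists K, d; split => // x y xd yd.
apply: mxnorm_le => [|i j]; first by rewrite mulr_ge0.
by have := h (i, j) x y xd yd; rewrite !mxE.
Qed.

Lemma loc_lip_mx_close m n (A : V -> 'M[R]_(m, n)) e : loc_lip_mx A -> 0 < e ->
  exists2 d, 0 < d & forall x, `|x - x0| <= d -> `|A x - A x0| <= e.
Proof.
move=> /loc_lip_mx_lipschitz[K [d [K0 d0 h]]] e0.
have K1 : 0 < K + 1 by lra.
exists (Num.min d (e / (K + 1))); first by rewrite lt_min d0 divr_gt0.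
move=> x; rewrite le_min => /andP[xd xe].
apply: le_trans (h _ _ xd _) _; first by rewrite subrr normr0 ltW.
rewrite (le_trans (ler_wpM2l K0 xe)) // mulrA ler_pdivrMr // mulrC.
by rewrite ler_wpM2l ?lerDl // ltW.
Qed.

Lemma loc_lip_mx_bounded m n (A : V -> 'M[R]_(m, n)) : loc_lip_mx A ->
  exists B d, [/\ 0 <= B, 0 < d & forall x, `|x - x0| <= d -> `|A x| <= B].
Proof.
move=> /loc_lip_mx_close/(_ ltr01)[d d0 h]; exists (`|A x0| + 1), d; split=> //.
by move=> x /h; have := ler_normD (A x - A x0) (A x0); rewrite subrK; lra.
Qed.

(** Bordering by fixed matrices [L] and [B] turns [A x0] into the identity, and
    the determinant of [L *m A x *m B] stays nonzero near [x0]. *)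
Lemma mxrank_lower_semicontinuous m n (A : V -> 'M[R]_(m, n)) : loc_lip_mx A ->
  exists2 d, 0 < d &
    forall x, `|x - x0| <= d -> (\rank (A x0) <= \rank (A x))%N.
Proof.
move=> hA.
pose L := pinvmx (col_base (A x0)); pose B := pinvmx (row_base (A x0)).
have LAB : L *m A x0 *m B = 1%:M.
  rewrite -[X in L *m X *m B](mulmx_base (A x0)) mulmxA.
  rewrite (mulVpmx (col_base_full _)) mul1mx.
  exact: mulmxVp (row_base_free _).
have ldet : loc_lip x0 (fun x => \det (L *m A x *m B)).
  rewrite /determinant; apply: loc_lip_sum => s.
  apply: loc_lipM; first exact: loc_lip_cst.
  apply: loc_lip_prod => i.
  apply: (@loc_lip_mxM _ _ _ (fun x => L *m A x) (fun=> B)); last exact: loc_lip_mx_cst.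
  apply: (@loc_lip_mxM _ _ _ (fun=> L) A) => //; exact: loc_lip_mx_cst.
have [d d0 h] := loc_lip_close ldet (divr_gt0 ltr01 (ltr0n R 2)).
exists d => // x /h; rewrite LAB det1 => hx.
have : \det (L *m A x *m B) != 0.
  by apply/eqP => D0; move: hx; rewrite D0 sub0r normrN normr1; lra.
rewrite -unitfE -unitmxE -row_free_unit => /eqP <-.
by apply: leq_trans (mxrankM_maxl _ _) _; exact: mxrankM_maxr.
Qed.

End Semicontinuity.

Section Continuity.
Variables (R : realType) (V : normedModType R).

Lemma loc_lip_continuous (f : V -> R) x : loc_lip x f -> {for x, continuous f}.
Proof.
move=> lf; apply/cvgrPdist_le => e e0.
have [d d0 h] := loc_lip_close lf e0.
near=> y; rewrite distrC; apply: h; rewrite distrC.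
by near: y; apply: cvgr_dist_le => //; exact: cvg_id.
Unshelve. all: by end_near. Qed.

End Continuity.

Lemma loc_lip_mx_trmx (R : realType) k l (x0 : 'M[R]_(k, l)) :
  loc_lip_mx x0 (fun x => x^T).
Proof.
move=> i j; exists 1, 1; split => // x y _ _; rewrite mul1r.
by have := ler_entry_norm (x - y) j i; rewrite !mxE.
Qed.

(** Compactness of the unit sphere, then homogeneity. *)
Lemma posdef_coercive (R : realType) k (M : 'M[R]_k) :
  (forall y : 'cV[R]_k, y != 0 -> 0 < inner y (M *m y)) ->
  exists2 c, 0 < c & forall y : 'cV[R]_k, c * inner y y <= inner y (M *m y).
Proof.
move=> pos.
pose S := [set y : 'rV[R]_k | `|y| = 1].
have [[y1 Sy1]|S0] := pselect (S !=set0); last first.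
  exists 1 => // y; have [->|y0] := eqVneq y 0.
    by rewrite mulmx0 mul1r.
  exfalso; apply: S0; exists (`|y^T|^-1 *: y^T).
  rewrite /S /= normrZ normfV normr_id mulVf // normr_eq0.
  by apply: contra_neq y0 => /(congr1 trmx); rewrite trmxK trmx0.
have cS : compact S.
  apply: bounded_closed_compact.
    by exists 1; split => // M' M1 y; rewrite /S /= => ->; exact: ltW.
  apply: (@preimage_closed _ _ (fun y : 'rV[R]_k => `|y|) [set 1]).
    by move=> y _; exact: norm_continuous.
  exact: closed_eq.
pose q (y : 'rV[R]_k) := inner y^T (M *m y^T).
have qc : continuous q.
  move=> y; apply: loc_lip_continuous; apply: loc_lip_sum => i.
  apply: loc_lipM; first exact: loc_lip_mx_trmx.
  apply: loc_lip_mxM; first exact: loc_lip_mx_cst.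
  exact: loc_lip_mx_trmx.
have [y2 /set_mem Sy2 ymin] := EVT_min_rV (ex_intro _ y1 Sy1) cS
  (continuous_subspaceT qc).
have q0 : 0 < q y2.
  apply: pos; apply: contraPneq Sy2 => /(congr1 trmx).
  by rewrite trmxK trmx0 /S /= => ->; rewrite normr0 => /eqP; rewrite eq_sym oner_eq0.
have k1 : 0 < k%:R + 1 :> R by rewrite ltr_wpDl.
exists (q y2 / (k%:R + 1)); first by rewrite divr_gt0.
move=> y; have [->|y0] := eqVneq y 0.
  by rewrite mulmx0 /inner big1 ?mulr0 // => i _; rewrite mxE mul0r.
have n0 : `|y^T| != 0.
  rewrite normr_eq0; apply: contra_neq y0 => /(congr1 trmx).
  by rewrite trmxK trmx0.
have Sy : S (`|y^T|^-1 *: y^T) by rewrite /S /= normrZ normfV normr_id mulVf.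
have qy : q (`|y^T|^-1 *: y^T) = inner y (M *m y) / `|y^T| ^+ 2.
  rewrite /q linearZ /= trmxK -scalemxAr /inner mulr_suml.
  by apply: eq_bigr => i _; rewrite 2!mxE; field.
have := ymin _ (mem_set Sy); rewrite qy ler_pdivlMr; last first.
  by rewrite exprn_gt0 // lt_neqAle eq_sym n0 /=.
apply: le_trans; rewrite -mulrA ler_wpM2l ?(ltW q0) //.
rewrite mulrC ler_pdivrMr //.
apply: le_trans (_ : k%:R * `|y^T| ^+ 2 <= _).
  apply: inner_le_norm => i; have := ler_entry_norm y^T ord0 i.
  by rewrite mxE.
by rewrite mulrC ler_wpM2l ?sqr_ge0 // lerDl.
Qed.

Section Coercivity.
Variables (R : realType) (V : normedModType R) (x0 : V).

(** The rank of [A] is locally constant, so the image of [A x] is spanned by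
    the images of a fixed family of vectors (the columns of [B]), in whose
    coordinates the restricted quadratic form is a matrix depending
    continuously on [x]. *)
Lemma coercive_on_image k m (A : V -> 'M[R]_(k, m)) (H : V -> 'M[R]_k) :
  loc_lip_mx x0 A -> loc_lip_mx x0 H ->
  (forall x, (\rank (A x) <= \rank (A x0))%N) ->
  (forall u, A x0 *m u != 0 -> 0 < inner (A x0 *m u) (H x0 *m (A x0 *m u))) ->
  exists c d, [/\ 0 < c, 0 < d & forall x u, `|x - x0| <= d ->
    c * inner (A x *m u) (A x *m u) <= inner (A x *m u) (H x *m (A x *m u))].
Proof.
move=> hA hH rk pos.
pose r := \rank (A x0).
pose B := pinvmx (row_base (A x0)).
pose A' x := A x *m B.
have hA' : loc_lip_mx x0 A' by apply: loc_lip_mxM => //; exact: loc_lip_mx_cst.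
have A'0 : A' x0 = col_base (A x0).
  by rewrite /A' -[X in X *m B](mulmx_base (A x0)) -mulmxA (mulmxVp (row_base_free _)) mulmx1.
have A'inj : pinvmx (col_base (A x0)) *m A' x0 = 1%:M.
  by rewrite A'0 (mulVpmx (col_base_full _)).
pose M x := (A' x)^T *m (H x *m A' x).
have hM : loc_lip_mx x0 M.
  by apply: loc_lip_mxM; [exact: loc_lip_mx_tr|exact: loc_lip_mxM].
have formM x y : inner (A' x *m y) (H x *m (A' x *m y)) = inner y (M x *m y).
  by rewrite inner_mulmx /M -(mulmxA (A' x)^T) -(mulmxA (H x)).
have [c c0 hc] : exists2 c, 0 < c &
    forall y : 'cV[R]_r, c * inner y y <= inner y (M x0 *m y).
  apply: posdef_coercive => y y0; rewrite -formM -mulmxA; apply: pos.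
  apply: contra_neq y0 => Ay; rewrite -(mul1mx y) -A'inj -mulmxA /A'.
  by rewrite -(mulmxA _ B) Ay mulmx0.
(* A perturbation of the entries by [e] changes the form by at most
   [e * r <= c / 2] times [inner y y]. *)
pose e := c / (2 * (r%:R + 1)).
have r1 : 0 < r%:R + 1 :> R by rewrite ltr_wpDl.
have e0 : 0 < e by rewrite divr_gt0 // mulr_gt0.
have [d1 d10 near1] := loc_lip_mx_close hM e0.
have [C [d2 [C0 d20 near2]]] := loc_lip_mx_bounded
  (loc_lip_mxM (loc_lip_mx_tr hA') hA').
have [d3 d30 near3] := mxrank_lower_semicontinuous hA'.
exists (c / 2 / (C * r%:R + 1)), (Num.min d1 (Num.min d2 d3)).
have C1 : 0 < C * r%:R + 1 by rewrite ltr_wpDl // mulr_ge0.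
split; [by rewrite !divr_gt0|by rewrite !lt_min d10 d20|].
move=> x u; rewrite !le_min => /and3P[/near1 le1 /near2 le2 /near3 le3].
have sub : ((A x)^T <= (A' x)^T)%MS.
  (* Equality of ranks makes the image of [A' x] all of the image of [A x];
     the matrix preorder compares row spaces, whence the transposes. *)
  have le : ((A' x)^T <= (A x)^T)%MS by rewrite /A' trmx_mul submxMl.
  rewrite -(geq_leqif (mxrank_leqif_sup le)) !mxrank_tr.
  apply: leq_trans (rk x) _; apply: leq_trans le3.
  by rewrite A'0 (eqP (col_base_full _)).
have [y ->] : exists y, A x *m u = A' x *m y.
  have /submxP[z hz] : (u^T *m (A x)^T <= (A' x)^T)%MS.
    exact: submx_trans (submxMl _ _) sub.
  by exists z^T; apply: (can_inj (@trmxK _ _ _)); rewrite trmx_mul hz [RHS]trmx_mul trmxK.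
rewrite formM inner_mulmx mulmxA.
have qA : inner y ((A' x)^T *m A' x *m y) <= (C * r%:R + 1) * inner y y.
  apply: le_trans (ler_norm _) _; apply: le_trans (qform_bound y _) _.
    by move=> i j; exact: le_trans (ler_entry_norm _ _ _) le2.
  by rewrite ler_wpM2r ?inner_ge0 // lerDl.
have qM : c / 2 * inner y y <= inner y (M x *m y).
  have : `|inner y ((M x - M x0) *m y)| <= e * r%:R * inner y y.
    by apply: qform_bound => i j; exact: le_trans (ler_entry_norm _ _ _) le1.
  rewrite mulmxBl.
  have -> : inner y (M x *m y - M x0 *m y) =
      inner y (M x *m y) - inner y (M x0 *m y).
    rewrite /inner -sumrB; apply: eq_bigr => i _.
    by rewrite [X in _ * X]mxE [X in _ * (_ + X)]mxE mulrBr.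
  have er : e * r%:R * inner y y <= c / 2 * inner y y.
    rewrite ler_wpM2r ?inner_ge0 // /e.
    by rewrite mulrAC ler_pdivrMr ?mulr_gt0 //; nra.
  by have := hc y; rewrite ler_norml => + /andP[+ _]; lra.
apply: le_trans qM; rewrite -[leLHS]mulrA ler_wpM2l ?divr_ge0 ?(ltW c0) //.
by rewrite mulrC ler_pdivrMr // mulrC.
Qed.

End Coercivity.

(** * The distance map and the rigidity matrix *)

Section Rigidity.
Variables (R : realType) (n d : nat) (G : sgraph n).
Local Notation config := 'cV[R]_(n * d).
Local Notation crd p v a := (p (mxvec_index v a) ord0).
Implicit Types p q : config.

Lemma src_lt_dst (k : 'I_(nedges G)) : (src k < dst k)%N.
Proof.
rewrite /src /dst; have := enum_valP k; rewrite inE.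
by case/andP.
Qed.

Lemma adj_src_dst (k : 'I_(nedges G)) : adj G (src k) (dst k).
Proof. by rewrite /src /dst; have := enum_valP k; rewrite inE => /andP[]. Qed.

Lemma edge_of_adj v w : adj G v w -> exists k : 'I_(nedges G),
  (src k = v /\ dst k = w) \/ (src k = w /\ dst k = v).
Proof.
have edge (v' w' : 'I_n) : (v' < w')%N -> adj G v' w' ->
    exists k : 'I_(nedges G), src k = v' /\ dst k = w'.
  move=> lt a; have e : (v', w') \in edges G by rewrite inE /= lt.
  by exists (enum_rank_in e (v', w')); rewrite /src /dst enum_rankK_in.
move=> vw; have [lt|lt|/val_inj eq] := ltngtP v w.
- by have [k ?] := edge _ _ lt vw; exists k; left.
- rewrite adj_sym in vw; have [k ?] := edge _ _ lt vw; exists k; by right.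
- by move: vw; rewrite eq adj_irr.
Qed.

Lemma rigidity_mulE p q k : (rigidity_mx G p *m q) k ord0 =
  \sum_a (crd p (src k) a - crd p (dst k) a) * (crd q (src k) a - crd q (dst k) a).
Proof.
rewrite mxE (reindex _ (curry_mxvec_bij _ _)) /=.
rewrite (eq_bigr (fun va : 'I_n * 'I_d =>
    rigidity_mx G p k (mxvec_index va.1 va.2) * crd q va.1 va.2)); last by case.
rewrite -(pair_bigA _ (fun v a =>
  rigidity_mx G p k (mxvec_index v a) * crd q v a)) /=.
under eq_bigr => v _ do under eq_bigr => a _ do rewrite mxE mxvecE mxE.
have ne : dst k != src k.
  by apply/eqP => e; have := src_lt_dst k; rewrite e ltnn.
rewrite (bigD1 (src k)) //= (bigD1 (dst k)) //= eqxx (negPf ne).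
rewrite [X in _ + (_ + X)]big1 ?addr0; last first.
  move=> v /andP[/negPf vs /negPf vd]; apply: big1 => a _.
  by rewrite vs vd mul0r.
rewrite -big_split /=; apply: eq_bigr => a _.
by rewrite eqxx !mxE; ring.
Qed.

Lemma distmapE p k : distmap G p k ord0 =
  \sum_a (crd p (src k) a - crd p (dst k) a) ^+ 2.
Proof.
rewrite mxE sqr_enorm; apply: eq_bigr => a _.
by rewrite !mxE; ring.
Qed.

(** The distance map is quadratic with polar form [R(p) q], so the mean value
    formula holds exactly, with the derivative taken at the midpoint. *)
Lemma distmap_midpoint p q : distmap G p - distmap G q =
  2 *: (rigidity_mx G (2^-1 *: (p + q)) *m (p - q)).
Proof.
apply/matrixP => k j; rewrite (ord1 j) [LHS]mxE [X in _ + X]mxE !distmapE.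
rewrite [RHS]mxE rigidity_mulE mulr_sumr -sumrB.
by apply: eq_bigr => a _; rewrite !mxE; field.
Qed.

Lemma distmap_line p u (s : R) : distmap G (p + s *: u) =
  distmap G p + (2 * s) *: (rigidity_mx G p *m u) + s ^+ 2 *: distmap G u.
Proof.
apply/matrixP => k j; rewrite (ord1 j) [RHS]mxE [X in _ = X + _]mxE.
rewrite [X in _ = _ + X + _]mxE [X in _ = _ + X]mxE !distmapE rigidity_mulE.
rewrite !mulr_sumr -!big_split /=.
by apply: eq_bigr => a _; rewrite !mxE; ring.
Qed.

Lemma loc_lip_rigidity_mx p : loc_lip_mx p (rigidity_mx G).
Proof.
have lc v a : loc_lip p (fun q => Defs.point q v a ord0).
  by under eq_fun do rewrite mxE; exact: loc_lip_coord.
move=> k c; case/mxvec_indexP: c => v a.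
under eq_fun do rewrite mxE mxvecE mxE.
have [_|_] := eqVneq v (src k).
  under eq_fun do rewrite mxE [X in _ + X]mxE.
  by apply: loc_lipD => //; exact: loc_lipN.
have [_|_] := eqVneq v (dst k); last exact: loc_lip_cst.
under eq_fun do rewrite mxE [X in _ + X]mxE.
by apply: loc_lipD => //; exact: loc_lipN.
Qed.

Lemma loc_lip_distmap p : loc_lip_mx p (distmap G).
Proof.
move=> k j; rewrite (ord1 j); under eq_fun do rewrite distmapE.
apply: loc_lip_sum => a; apply: loc_lipX; apply: loc_lipD.
  exact: loc_lip_coord.
by apply: loc_lipN; exact: loc_lip_coord.
Qed.

Lemma rank_rigidity_le p : (\rank (rigidity_mx G p) <= max_rank R d G)%N.
Proof.
have lt : (\rank (rigidity_mx G p) < (nedges G).+1)%N by rewrite ltnS rank_leq_row.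
apply: (@leq_bigmax_cond _ _ (fun k : 'I_(nedges G).+1 => k : nat) (Ordinal lt)).
by apply/asboolP; exists p.
Qed.

Lemma same_differences_distmap p q :
  (forall (k : 'I_(nedges G)) a, crd p (src k) a - crd p (dst k) a =
    crd q (src k) a - crd q (dst k) a) ->
  distmap G p = distmap G q /\
  rigidity_mx G p = rigidity_mx G q.
Proof.
move=> h; split; apply/matrixP => k j.
  by rewrite (ord1 j) !distmapE; apply: eq_bigr => a _; rewrite h.
case/mxvec_indexP: j => v a; rewrite !mxE !mxvecE !mxE (h k a).
case: eqP => // _; case: eqP => // _.
by rewrite -opprB (h k a) opprB.
Qed.

(** Fibres of the distance map are compact up to translating the connected
    components of the graph: pin one vertex of each component at the origin. *)
Lemma pinned_representative p (B : R) :
  0 <= B -> (forall k, distmap G p k ord0 <= B) ->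
  exists q, [/\ distmap G q = distmap G p,
    rigidity_mx G q = rigidity_mx G p & `|q| <= n%:R * (B + 1)].
Proof.
move=> B0 hB.
pose q : config := (mxvec (\matrix_(v < n, a < d)
  (crd p v a - crd p (fingraph.root (adj G) v) a)))^T.
have qE v a : crd q v a = crd p v a - crd p (fingraph.root (adj G) v) a.
  by rewrite mxE mxvecE mxE.
have csym : connect_sym (adj G) := sym_connect_sym (@adj_sym _ G).
exists q; have [|-> ->] := @same_differences_distmap q p.
  move=> k a; rewrite !qE.
  have -> : fingraph.root (adj G) (src k) = fingraph.root (adj G) (dst k).
    by apply/(fingraph.rootP csym)/connect1; exact: adj_src_dst.
  by rewrite opprB addrA subrK.
split=> //; apply: mxnorm_le => [|c j]; first by rewrite mulr_ge0 ?addr_ge0.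
rewrite (ord1 j) {j}; case/mxvec_indexP: c => v a; rewrite qE.
have edge (k : 'I_(nedges G)) : `|crd p (src k) a - crd p (dst k) a| <= B + 1.
  have := hB k; rewrite distmapE (bigD1 a) //= -real_normK ?num_real //.
  set S := \sum_(_ | _) _; have S0 : 0 <= S by apply: sumr_ge0 => b _; exact: sqr_ge0.
  (* [t ^+ 2 <= B] gives [t <= B + 1] without taking a square root. *)
  move: (`|_ - _|) => t; nra.
have step w w' : adj G w w' -> `|crd p w a - crd p w' a| <= B + 1.
  by case/edge_of_adj => k [[<- <-]|[<- <-]] //; rewrite distrC.
have walk s w : path (adj G) w s ->
    `|crd p w a - crd p (last w s) a| <= (size s)%:R * (B + 1).
  elim: s w => [|w' s IH] w /=; first by rewrite subrr normr0 mul0r.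
  case/andP=> /step le1 /IH le2.
  apply: le_trans (ler_distD (crd p w' a) _ _) _.
  by rewrite -natr1 mulrDl mul1r addrC lerD.
have /connectP[s0 ps0 ->] := connect_root (adj G) v.
(* A simple path has fewer than [n] steps. *)
case: (shortenP ps0) => s ps us _; apply: le_trans (walk _ _ ps) _.
rewrite ler_wpM2r ?addr_ge0 // ler_nat.
have := max_card (mem (v :: s)); rewrite card_ord (card_uniqP us) /=.
exact: ltnW.
Qed.

End Rigidity.

(** * Regular points and tangent vectors *)

Section Nbhs.
Variables (R : realType) (V : normedModType R).

Lemma nbhs_closed_ball (x : V) (P : set V) : nbhs x P ->
  exists2 e, 0 < e & forall y, `|y - x| <= e -> P y.
Proof.
move=> /nbhs_ballP[e /= e0 h]; exists (e / 2); first by rewrite divr_gt0.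
by move=> y yx; apply: h; rewrite -ball_normE /= distrC; lra.
Qed.

Lemma closed_ball_nbhs (x : V) (P : set V) e : 0 < e ->
  (forall y, `|y - x| <= e -> P y) -> nbhs x P.
Proof.
move=> e0 h; apply/nbhs_ballP; exists e => //= y.
by rewrite -ball_normE /= distrC => /ltW/h.
Qed.

End Nbhs.

Lemma norm_trmx_le (R : realType) m n (A : 'M[R]_(m, n)) : `|A^T| <= `|A|.
Proof. by apply: mxnorm_le => // i j; rewrite mxE ler_entry_norm. Qed.

Lemma is_derive_scalel (R : realType) (E : normedModType R) (k : R -> R) (e : E)
    (t k' : R) : is_derive t (1 : R) k k' ->
  is_derive t (1 : R) (fun s => k s *: e) (k' *: e).
Proof.
move=> Dk; have dk : differentiable k t by apply/derivable1_diffP; case: Dk.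
have dke : differentiable (fun s => k s *: e) t by exact: differentiableZl.
apply: DeriveDef; first exact: diff_derivable.
by rewrite deriveE // diffZl // -deriveE // derive_val.
Qed.

Section RegularPoints.
Variables (R : realType) (n d : nat) (G : sgraph n).
Local Notation config := 'cV[R]_(n * d).
Implicit Types p q : config.

(** If no tolerance [e] worked, configurations of smaller rank, which may be
    pinned and thus kept in a compact set, would accumulate at a point of the
    fibre of [m], and lower semicontinuity of the rank would be violated there.
    The compactness is used in its covering form, uniformly in [e]. *)
Lemma rank_near_fibre m r :
  (forall p, distmap G p = m -> (r <= \rank (rigidity_mx G p))%N) ->
  exists2 e, 0 < e &
    forall p, `|distmap G p - m| <= e -> (r <= \rank (rigidity_mx G p))%N.
Proof.
move=> hm; pose rho := n%:R * (`|m| + 1 + 1).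
pose K := [set q : 'rV[R]_(n * d) | `|q| <= rho].
have cK : compact K.
  apply: bounded_closed_compact.
    exists rho; split => [|M' M1 y /= /le_trans]; first exact: num_real.
    by apply; exact: ltW.
  apply: (@preimage_closed _ _ (fun y : 'rV[R]_(n * d) => `|y|) [set t | t <= rho]).
    by move=> y _; exact: norm_continuous.
  exact: closed_le.
pose P (e : R) (q : 'rV[R]_(n * d)) :=
  `|distmap G q^T - m| <= e -> (r <= \rank (rigidity_mx G q^T))%N.
have transposed (q : 'rV[R]_(n * d)) (S : set config) e : 0 < e ->
    (forall p, `|p - q^T| <= e -> S p) -> nbhs q [set q' : 'rV[R]_(n * d) | S q'^T].
  move=> e0 h; apply: (closed_ball_nbhs e0) => q' q'q; apply: h.
  by rewrite -linearB /= (le_trans (norm_trmx_le _)).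
(* [K] contains a pinned representative of every configuration whose edge
   vector is within 1 of [m]. *)
have : \forall e \near 0^'+, K `<=` P e.
  apply: (proj1 (@compact_near_coveringP _ K) cK) => q _.
  have [Fq|Fq] := eqVneq (distmap G q^T) m.
    have [e e0 he] := mxrank_lower_semicontinuous (@loc_lip_rigidity_mx _ _ _ G q^T).
    exists ([set q' | (r <= \rank (rigidity_mx G q'^T))%N], setT) => /=.
      split; last exact: filterT.
      apply: (transposed q [set p | (r <= \rank (rigidity_mx G p))%N] e e0) => p.
      by move=> /he; apply: leq_trans; exact: hm.
    by move=> [q' e'] [/= hq' _] _.
  have s0 : 0 < `|distmap G q^T - m| by rewrite normr_gt0 subr_eq0.
  set s := `|_| in s0.
  have s20 : 0 < s / 2 by rewrite divr_gt0.
  have [e e0 he] := loc_lip_mx_close (@loc_lip_distmap _ _ _ G q^T) s20.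
  exists ([set q' | `|distmap G q'^T - distmap G q^T| <= s / 2],
          [set e | e < s / 2]) => /=.
    split; first exact: (transposed q
      [set p | `|distmap G p - distmap G q^T| <= s / 2] e e0).
    exact: nbhs_right_lt.
  move=> [q' e'] /= [h1 h2] h3; exfalso.
  have := ler_distD (distmap G q'^T) (distmap G q^T) m.
  by rewrite -/s distrC; lra.
move=> nearP.
have [e [[hK e1] e0]] : exists e : R, ((K `<=` P e) /\ e < 1) /\ 0 < e.
  near (0 : R)^'+ => e; exists e; split; [split|].
  - by near: e.
  - by near: e; exact: nbhs_right_lt.
  - by near: e; exact: nbhs_right_gt.
exists e => // p hp.
have [|k|q [qF qR qrho]] := @pinned_representative R n d G p (`|m| + 1).
- by rewrite addr_ge0.
- have := ler_entry_norm (distmap G p - m) k ord0.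
  have := ler_entry_norm m k ord0; rewrite [X in _ -> `|X| <= _ -> _]mxE.
  rewrite [X in _ -> `|_ + X| <= _ -> _]mxE => h1 h2.
  have := ler_norm (m k ord0); have := ler_norm (distmap G p k ord0 - m k ord0).
  lra.
have := hK q^T; rewrite /P trmxK qF qR; apply => //.
by rewrite /K /= (le_trans (norm_trmx_le _)).
Unshelve. all: by end_near. Qed.

(** The chart witnessing that the image is a submanifold at [distmap G p] is a
    chart at every value in its domain; the rank condition on nearby fibres is
    [rank_near_fibre]. *)
Lemma regular_points_open p : regular_points R d G p ->
  exists2 e, 0 < e & forall q, `|q - p| <= e -> regular_points R d G q.
Proof.
move=> [_ [rN [W [W' [phi [psi [[oW Wp] oW' smooth inv flat]]]]]] rk].
have [e e0 he] : exists2 e, 0 < e & forall q,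
    `|distmap G q - distmap G p| <= e -> \rank (rigidity_mx G q) = max_rank R d G.
  have [|e e0 he] := @rank_near_fibre (distmap G p) (max_rank R d G).
    by move=> q /rk ->.
  exists e => // q /he rq; apply/eqP.
  by rewrite eqn_leq rq rank_rigidity_le.
have [w w0 hw] := nbhs_closed_ball (open_nbhs_nbhs (conj oW Wp)).
have ew0 : 0 < Num.min e w by rewrite lt_min e0.
have [a a0 ha] := loc_lip_mx_close (@loc_lip_distmap _ _ _ G p) ew0.
exists a => // q /ha; rewrite le_min => /andP[qe qw].
split.
- by exists q.
- by split=> //; exists W, W', phi, psi; split => //; split => //; exact: hw.
- by move=> p' p'q; apply: he; rewrite p'q.
Qed.

Lemma is_derive_parabola (E : normedModType R) (a b c : E) (t : R) :
  is_derive t (1 : R) (fun t : R => a + t *: b + t ^+ 2 *: c) (b + (2 * t) *: c).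
Proof.
have Dl : is_derive t (1 : R) (fun t : R => t *: b) b.
  by rewrite -[X in is_derive _ _ _ X]scale1r; exact: is_derive_scalel.
have Dq : is_derive t (1 : R) (fun t : R => t ^+ 2 *: c) ((2 * t) *: c).
  apply: is_derive_scalel; apply: is_derive_eq.
  by rewrite /GRing.scale /=; ring.
rewrite (_ : b + _ = 0 + b + (2 * t) *: c); last by rewrite add0r.
exact: (is_deriveD (is_deriveD (is_derive_cst a t 1) Dl) Dq).
Qed.

Lemma Ck_on_parabola (k : nat) (E : normedModType R) (A : set R) (a b c : E) :
  Ck_on k A (fun t : R => a + t *: b + t ^+ 2 *: c).
Proof.
have diff (a' b' c' : E) (t : R) :
    differentiable (fun t : R => a' + t *: b' + t ^+ 2 *: c') t.
  by apply/derivable1_diffP; case: (is_derive_parabola a' b' c' t).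
elim: k a b c => [|k IH] a b c /=.
  by move=> t _; apply: differentiable_continuous; exact: diff.
split=> [t _|v]; first exact: diff.
rewrite (_ : (fun x => _) = (fun t : R => v *: b + t *: ((2 * v) *: c) + t ^+ 2 *: (0 : E))).
  exact: IH.
apply/funext => t /=.
rewrite deriv1E; last by case: (is_derive_parabola a b c t).
have := is_derive_parabola a b c t => Dt.
rewrite derive1E derive_val scaler0 addr0 scalerDr !scalerA.
by congr (_ + _ *: _); ring.
Qed.

(** The image under the distance map of the line through [p] with direction
    [u / 2] is a parabola with initial velocity [rigidity_mx G p *m u], and it
    stays among the regular values for small times. *)
Lemma rigidity_image_tangent p u : regular_points R d G p ->
  tangent_space (regular_values R d G) (distmap G p) (rigidity_mx G p *m u).
Proof.
move=> rp; have [e e0 he] := regular_points_open rp.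
pose v := 2^-1 *: u.
pose g t := distmap G p + t *: (rigidity_mx G p *m u) + t ^+ 2 *: distmap G v.
have gE t : g t = distmap G (p + t *: v).
  rewrite distmap_line /g /v -scalemxAr scalerA; congr (_ + _ *: _ + _).
  by field.
have v1 : 0 < `|v| + 1 by rewrite ltr_wpDl.
exists g, (e / (`|v| + 1)); split.
- by rewrite divr_gt0.
- by move=> k; exact: Ck_on_parabola.
- by rewrite /g expr0n !scale0r !addr0.
- move=> t te; rewrite gE; apply: he.
  rewrite addrAC subrr add0r normrZ.
  apply: le_trans (_ : `|t| * (`|v| + 1) <= e).
    by rewrite ler_wpM2l // lerDl.
  by rewrite -ler_pdivlMr // ltW.
- have D0 := is_derive_parabola (distmap G p) (rigidity_mx G p *m u) (distmap G v) 0.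
  by rewrite derive_val mulr0 scale0r addr0.
Qed.

End RegularPoints.

(** * Estimates along the flow *)

Lemma ode_on_ext (R : realType) N (g g' : 'cV[R]_N -> 'cV[R]_N) T x :
  (forall t, 0 < t < T -> g (x t) = g' (x t)) -> ode_on g T x -> ode_on g' T x.
Proof. by move=> e h i; have [c D] := h i; split => // t tT; rewrite -e //; exact: D. Qed.

Lemma cvg_cV (R : realType) (T : Type) (F : set_system T) (FF : Filter F) N
    (f : T -> 'cV[R]_N) (l : 'cV[R]_N) :
  (forall i, f x i ord0 @[x --> F] --> l i ord0) -> f x @[x --> F] --> l.
Proof.
move=> h; apply/cvgrPdist_le => e e0.
near=> s; apply: mxnorm_le => [|i j]; first exact: ltW.
have -> : j = ord0 := ord1 j.
rewrite !mxE {j}; move: i; near: s; apply: filter_forall => i.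
exact: (proj1 (cvgrPdist_le _ _) (h i)).
Unshelve. all: by end_near. Qed.

Lemma ode_on_continuous (R : realType) N (g : 'cV[R]_N -> 'cV[R]_N) T x :
  ode_on g T x -> {within `[0, T], continuous x}.
Proof. by move=> hx t; apply: cvg_cV => i; exact: (hx i).1. Qed.

Lemma loc_lip_comp_continuous (R : realType) (V : normedModType R)
    (f : V -> R) (a b : R) (x : R -> V) :
  (forall y, loc_lip y f) -> {within `[a, b], continuous x} ->
  {within `[a, b], continuous (fun t => f (x t))}.
Proof.
move=> lf cx t; have c1 := cx t; have c2 := loc_lip_continuous (lf (x t)).
exact: (cvg_comp _ _ c1 c2).
Qed.

Section Clamp.
Variables (R : realType) (N : nat) (x0 : 'cV[R]_N) (r : R).
Hypothesis r_ge0 : 0 <= r.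

(** Truncating each coordinate does not increase sup-norm distances and fixes
    the ball, so composing with it extends a field from the ball to a bounded
    and globally Lipschitz one. *)
Definition clamp (x : 'cV[R]_N) : 'cV[R]_N :=
  \col_i Num.max (x0 i ord0 - r) (Num.min (x0 i ord0 + r) (x i ord0)).

Lemma clamp_ball x : `|clamp x - x0| <= r.
Proof.
apply: mxnorm_le => // i j; have -> : j = ord0 := ord1 j; rewrite !mxE ler_norml.
move: (x0 i ord0) (x i ord0) r_ge0 => a b r0.
case: (leP (a + r) b) => ?; case: (leP (a - r) _) => ?; apply/andP; split; lra.
Qed.

Lemma clamp_id x : `|x - x0| <= r -> clamp x = x.
Proof.
move=> h; apply/matrixP => i j; have -> : j = ord0 := ord1 j; rewrite !mxE.
have := ler_entry_norm (x - x0) i ord0; rewrite !mxE => /le_trans/(_ h).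
move: (x0 i ord0) (x i ord0) r_ge0 => a b r0.
by rewrite ler_norml => /andP[h1 h2]; rewrite min_r ?max_r; lra.
Qed.

Lemma clamp_lipschitz x y : `|clamp x - clamp y| <= `|x - y|.
Proof.
apply: mxnorm_le => // i j; have -> : j = ord0 := ord1 j; rewrite !mxE.
have := ler_entry_norm (x - y) i ord0; rewrite !mxE => /(le_trans _); apply.
move: (x0 i ord0) (x i ord0) (y i ord0) => a b e.
have := ler_norm (b - e); have := ler_norm (e - b).
rewrite distrC ler_norml => ? ?; have r0 := r_ge0.
case: (leP (a + r) b) => ?; case: (leP (a + r) e) => ?;
  do 2?[case: (leP (a - r) _) => ?]; apply/andP; split; lra.
Qed.

End Clamp.

Section Flow.
Variables (R : realType) (n d : nat) (G : sgraph n).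
Local Notation config := 'cV[R]_(n * d).
Local Notation edgevec := 'cV[R]_(nedges G).

Lemma is_derive_distmap (x : R -> config) (dx : config) (t : R) k :
  (forall i, is_derive t (1 : R) (fun t => x t i ord0) (dx i ord0)) ->
  is_derive t (1 : R) (fun t => distmap G (x t) k ord0)
    ((2 *: (rigidity_mx G (x t) *m dx)) k ord0).
Proof.
move=> Dx.
rewrite (_ : (fun t => _) = \sum_a (fun t =>
    x t (mxvec_index (src k) a) ord0 - x t (mxvec_index (dst k) a) ord0) ^+ 2);
  last by apply/funext => s; rewrite distmapE fct_sumE.
rewrite mxE rigidity_mulE mulr_sumr; apply: is_derive_sum => a.
have Da := is_deriveB (Dx (mxvec_index (src k) a)) (Dx (mxvec_index (dst k) a)).
by apply: is_derive_eq; rewrite /GRing.scale /=; ring.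
Qed.

Variables (pstar : config) (mstar : edgevec) (g : config -> config).
Variables (H : config -> 'M[R]_(nedges G)) (c K delta : R).
Hypothesis c_gt0 : 0 < c.
Local Notation err p := (mstar - distmap G p).
Local Notation inball p := (`|p - pstar| <= delta).
Hypothesis g_err : forall p, inball p ->
  2 *: (rigidity_mx G p *m g p) = H p *m err p.
Hypothesis g_bound : forall p, inball p -> `|g p| <= K * enorm (err p).
Hypothesis coercive : forall p, inball p ->
  c * inner (err p) (err p) <= inner (err p) (H p *m err p).

(** The squared error [E] satisfies [E' <= - 2 c E], so [E expR (2 c t)] does not
    increase. *)
Lemma err_decay T x : 0 <= T -> ode_on g T x ->
  (forall t, 0 <= t <= T -> inball (x t)) ->
  enorm (err (x T)) <= enorm (err (x 0)) * expR (- c * T).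
Proof.
move=> T0 hx ball.
pose f t := - (inner (err (x t)) (err (x t)) * expR (2 * c * t)).
pose df t := - ((- 2 * inner (err (x t)) (H (x t) *m err (x t)) +
  2 * c * inner (err (x t)) (err (x t))) * expR (2 * c * t)).
have fle : f 0 <= f T.
  apply: (@ge0_derive_le R f df) => //.
  - move=> t; apply: cvgN; apply: cvgM.
      apply: (@loc_lip_comp_continuous _ _ (fun p => inner (err p) (err p)));
        last exact: ode_on_continuous hx.
      move=> p; have le := loc_lip_mxB (loc_lip_mx_cst p mstar) (@loc_lip_distmap R n d G p).
      by apply: loc_lip_sum => k; apply: loc_lipM; exact: le.
    apply: continuous_subspaceT => s; have := @continuous_scaled_expR R 1 (2 * c) s.
    by under eq_fun do rewrite mul1r.
  - move=> t tT.
    have Derr k : is_derive t (1 : R) (fun t => err (x t) k ord0)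
        (- ((H (x t) *m err (x t)) k ord0)).
      rewrite -g_err; last by apply: ball; lra.
      have Dk := @is_derive_distmap x (g (x t)) t k (fun i => (hx i).2 t tT).
      rewrite (_ : (fun t => _) = cst (mstar k ord0) - (fun t => distmap G (x t) k ord0));
        last by apply/funext => s; rewrite entry_sub.
      by rewrite -[X in is_derive _ _ _ X]add0r; exact: is_deriveB.
    have DE : is_derive t (1 : R) (fun t => inner (err (x t)) (err (x t)))
        (- 2 * inner (err (x t)) (H (x t) *m err (x t))).
      have -> : (fun t => inner (err (x t)) (err (x t))) =
          \sum_k (fun t => err (x t) k ord0) ^+ 2.
        by apply/funext => s; rewrite fct_sumE; apply: eq_bigr => k _; rewrite expr2.
      rewrite mulr_sumr; apply: is_derive_sum => k.
      by apply: is_derive_eq; rewrite /GRing.scale /=; ring.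
    have Dexp := @is_derive_scaled_expR R 1 (2 * c) t.
    have -> : f = - ((fun t => inner (err (x t)) (err (x t))) *
        (fun t => 1 * expR (2 * c * t))).
      by apply/funext => s; rewrite /f -[in LHS](mul1r (expR _)).
    by apply: is_derive_eq; rewrite /df /GRing.scale /=; ring.
  - move=> t tT; rewrite /df oppr_ge0 pmulr_lle0 ?expR_gt0 //.
    have := coercive (ball t _); have := c_gt0; lra.
rewrite -ler_sqr ?nnegrE ?mulr_ge0 ?expR_ge0 ?enorm_ge0 //.
rewrite [leRHS]exprMn (sqr_enorm (err (x T))) (sqr_enorm (err (x 0))) -(expRM_natr 2 (- c * T)).
move: fle; rewrite /f lerN2 mulr0 expR0 mulr1 => fle.
rewrite (_ : - c * T * 2 = - (2 * c * T)) ?expRN ?ler_pdivlMr ?expR_gt0 //; lra.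
Qed.

(** Integrate the exponentially decaying speed bound from [s] to [T]. *)
Lemma flow_increment T x : 0 <= T -> ode_on g T x ->
  (forall t, 0 <= t <= T -> inball (x t)) -> 0 <= K ->
  forall s, 0 <= s <= T ->
  `|x T - x s| <= K * enorm (err (x 0)) / c * (expR (- c * s) - expR (- c * T)).
Proof.
move=> T0 hx ball K0 s sT; set A := _ / c.
have A0 : 0 <= A by rewrite divr_ge0 ?mulr_ge0 ?enorm_ge0 // ltW.
have mono : expR (- c * T) <= expR (- c * s).
  by rewrite ler_expR ler_wnM2l ?oppr_le0 ?(ltW c_gt0) //; lra.
apply: mxnorm_le => [|i j]; first by rewrite mulr_ge0 // subr_ge0.
rewrite (ord1 j) {j}; have [ci Di] := hx i.
rewrite entry_sub (_ : A * _ = - A * expR (- c * T) - - A * expR (- c * s)); last by ring.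
apply: (@increment_le R (fun t => x t i ord0) (fun t => - A * expR (- c * t))
  (fun t => g (x t) i ord0) (fun t => - A * (- c) * expR (- c * t))).
- by lra.
- by apply: continuous_subspaceW ci; apply: subset_itvr; rewrite bnd_simp; lra.
- by apply: continuous_subspaceT => t; exact: continuous_scaled_expR.
- by move=> t tT; apply: Di; lra.
- by move=> t _; exact: is_derive_scaled_expR.
- move=> t tT; have tT' : 0 <= t <= T by lra.
  apply: le_trans (ler_entry_norm _ _ _) _.
  apply: le_trans (g_bound (ball t tT')) _.
  have /le_trans : enorm (err (x t)) <= enorm (err (x 0)) * expR (- c * t).
    apply: err_decay; [lra| |].
      by apply: ode_onW hx; lra.
    by move=> r rt; apply: ball; lra.
  move=> /(_ _ (lexx _)) le; apply: le_trans (ler_wpM2l K0 le) _.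
  by rewrite /A le_eqVlt; apply/orP; left; apply/eqP; field; rewrite gt_eqF.
Qed.

(** As long as the trajectory is in the ball it moves by at most [delta / 4] from
    a starting point itself within [delta / 4] of the target, so it is in the
    half ball; [bootstrap] removes the proviso. The field [g'] may differ from
    [g] outside the ball, as the truncated field does. *)
Lemma flow_trapped T x g' : 0 <= T -> 0 <= K -> 0 < delta ->
  (forall p, inball p -> g' p = g p) -> ode_on g' T x ->
  `|x 0 - pstar| <= delta / 4 ->
  K * enorm (err (x 0)) / c <= delta / 4 ->
  forall t, 0 <= t <= T -> `|x t - pstar| <= delta / 2.
Proof.
move=> T0 K0 d0 eqg hx x0 e0.
apply: (@bootstrap R (fun t => `|x t - pstar|)) => //; last by lra.
  apply: (@loc_lip_comp_continuous _ _ (fun p => `|p - pstar|));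
    last exact: ode_on_continuous hx.
  move=> p; exists 1, 1; split => // u v _ _; rewrite mul1r.
  by apply: le_trans (ler_dist_dist _ _) _; rewrite opprB addrA subrK.
move=> t tT ball.
have hg : ode_on g t x.
  apply: (@ode_on_ext _ _ g') => [s st|]; first by apply: eqg; apply: ball; lra.
  by apply: ode_onW hx; lra.
have t0 : 0 <= t by lra.
have := flow_increment t0 hg ball K0 (s := 0); rewrite lexx t0 => /(_ isT).
rewrite mulr0 expR0 => incr.
apply: le_trans (ler_distD (x 0) _ _) _.
have : K * enorm (err (x 0)) / c * (1 - expR (- c * t)) <= delta / 4 * 1.
  apply: ler_pM => //.
  - by rewrite divr_ge0 ?mulr_ge0 ?enorm_ge0 // ltW.
  - by rewrite subr_ge0 -expR0 ler_expR mulNr oppr_le0 mulr_ge0 // ltW.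
lra.
Qed.

Variable L : R.
Hypotheses (K_ge0 : 0 <= K) (L_gt0 : 0 < L) (delta_gt0 : 0 < delta).
Hypothesis g_star : g pstar = 0.
Hypothesis g_lipschitz : forall p q, inball p -> inball q ->
  `|g p - g q| <= L * `|p - q|.

Definition small_start (p : config) :=
  `|p - pstar| <= delta / 4 /\ K * enorm (err p) / c <= delta / 4.

Lemma flow_stays T x : 0 <= T -> ode_on g T x -> small_start (x 0) ->
  forall t, 0 <= t <= T -> `|x t - pstar| <= delta / 2.
Proof. by move=> T0 hx [x0 e0]; exact: (@flow_trapped T x g). Qed.

Let half_ball p : `|p - pstar| <= delta / 2 -> inball p.
Proof. by have := delta_gt0; lra. Qed.

Lemma flow_unique T x y : 0 <= T -> ode_on g T x -> ode_on g T y ->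
  x 0 = y 0 -> small_start (x 0) -> x T = y T.
Proof.
move=> T0 hx hy xy sx.
have bx t : 0 <= t <= T -> inball (x t).
  by move=> tT; apply: half_ball; exact: flow_stays hx sx t tT.
have bally t : 0 <= t <= T -> inball (y t).
  by rewrite xy in sx => tT; apply: half_ball; exact: flow_stays hy sx t tT.
apply: (@ode_unique R (n * d) g L (delta + delta) T) => // t tT.
  apply: le_trans (ler_distD pstar _ _) _; rewrite (distrC pstar).
  by rewrite lerD ?bx ?bally.
by apply: g_lipschitz; [exact: bx|exact: bally].
Qed.

Lemma flow_exists p : small_start p -> exists x, [/\ x 0 = p,
  forall i (t : R), 0 <= t -> {for t, continuous (fun t => x t i ord0)},
  forall T, ode_on g T x &
  forall t, 0 <= t -> `|x t - pstar| <= delta / 2].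
Proof.
move=> [p0 e0].
have dle := ltW delta_gt0.
pose g' := g \o clamp pstar delta.
have g'_bound q : `|g' q| <= L * delta.
  rewrite -[g' q]subr0 -g_star; apply: le_trans (g_lipschitz _ _) _.
  - exact: clamp_ball.
  - by rewrite subrr normr0.
  - by rewrite ler_wpM2l ?(ltW L_gt0) //; exact: clamp_ball.
have g'_lip q r : `|g' q - g' r| <= L * `|q - r|.
  apply: le_trans (g_lipschitz _ _) _; rewrite ?clamp_ball //.
  by rewrite ler_wpM2l ?(ltW L_gt0) //; exact: clamp_lipschitz.
have g'g q : inball q -> g' q = g q by move=> /clamp_id; rewrite /g' /= => ->.
have [x [x0 cx hx]] := ode_exists p g'_bound g'_lip L_gt0.
have bx t : 0 <= t -> `|x t - pstar| <= delta / 2.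
  move=> t0; apply: (@flow_trapped t x g' t0 K_ge0 delta_gt0 g'g (hx t)).
  - by rewrite x0; exact: p0.
  - by rewrite x0; exact: e0.
  - by rewrite t0 lexx.
exists x; split => // T; apply: (@ode_on_ext _ _ g') => // t tT.
by apply: g'g; apply: half_ball; apply: bx; lra.
Qed.

(** The exponential bound on increments makes the trajectory Cauchy, at the rate
    at which it then approaches its limit. *)
Lemma flow_limit x : small_start (x 0) -> (forall T, ode_on g T x) ->
  exists2 q, inball q &
    forall t, 0 <= t -> `|x t - q| <= delta / 4 * expR (- c * t).
Proof.
move=> sx hx.
have bx t : 0 <= t -> `|x t - pstar| <= delta / 2.
  by move=> t0; apply: (flow_stays t0 (hx t) sx); rewrite t0 lexx.
pose e t := delta / 4 * expR (- c * t).
have e0 t : 0 <= e t by rewrite mulr_ge0 ?expR_ge0 // divr_ge0 // ltW.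
have close s t : 0 <= s <= t -> `|x s - x t| <= e s + e t.
  move=> st; have t0 : 0 <= t by lra.
  have ball r : 0 <= r <= t -> inball (x r).
    by move=> rt; apply: half_ball; apply: bx; lra.
  have := flow_increment t0 (hx t) ball K_ge0 st; rewrite distrC => /le_trans; apply.
  rewrite mulrBr lerD //.
    by rewrite ler_wpM2r ?expR_ge0 //; exact: sx.2.
  apply: le_trans (e0 t); rewrite oppr_le0.
  by rewrite mulr_ge0 ?expR_ge0 // divr_ge0 ?mulr_ge0 ?enorm_ge0 // ltW.
(* Negative times are folded to 0, so that [common_limit] applies to a family
   indexed by [R]. *)
pose pos (t : R) := Num.max 0 t.
have pos0 t : 0 <= pos t by rewrite le_max lexx.
have posE t : 0 <= t -> pos t = t by move=> t0; rewrite /pos max_r.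
have dist s t : `|x (pos s) - x (pos t)| <= e (pos s) + e (pos t).
  have [st|/ltW ts] := leP (pos s) (pos t); first by apply: close; rewrite pos0.
  by rewrite distrC (addrC (e _)); apply: close; rewrite pos0.
have coord i : exists l, forall t, `|x (pos t) i ord0 - l| <= e (pos t).
  apply: (@common_limit R R 0 (fun t => x (pos t) i ord0) (fun t => e (pos t))).
  move=> s t; rewrite -entry_sub.
  exact: le_trans (ler_entry_norm _ _ _) (dist s t).
have [l hl] := choice coord.
have lim t : 0 <= t -> `|x t - \col_i l i| <= e t.
  move=> t0; apply: mxnorm_le => // i j; have -> : j = ord0 := ord1 j.
  by have := hl i t; rewrite posE // !mxE.
exists (\col_i l i) => //.
apply: le_trans (ler_distD (x 0) _ _) _; rewrite distrC.
have := lim 0 (lexx 0); rewrite /e mulr0 expR0.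
by have := bx 0 (lexx 0); have := delta_gt0; lra.
Qed.

End Flow.

(** * The closed loop *)

Section Derivatives.
Variable R : realType.

Lemma is_derive_cvgP (W : normedModType R) (f : R -> W) (t : R) (df : W) :
  is_derive t (1 : R) f df <->
  h^-1 *: (f (h *: 1 + t) - f t) @[h --> 0^'] --> df.
Proof.
split=> [[D <-]|D]; first exact: D.
by apply: DeriveDef; [exact: cvgP D|exact: cvg_lim D].
Qed.

Lemma is_derive_cV N (x : R -> 'cV[R]_N) (dx : 'cV[R]_N) (t : R) :
  (forall i, is_derive t (1 : R) (fun t => x t i ord0) (dx i ord0)) ->
  is_derive t (1 : R) x dx.
Proof.
move=> h; apply/is_derive_cvgP; apply: cvg_cV => i.
move/is_derive_cvgP: (h i); apply: cvg_trans; apply: near_eq_cvg.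
by near=> s; rewrite !mxE.
Unshelve. all: by end_near. Qed.

Lemma is_derive_pair (V W : normedModType R) (x : R -> V) (y : R -> W) dx dy
    (t : R) : is_derive t (1 : R) x dx -> is_derive t (1 : R) y dy ->
  is_derive t (1 : R) (fun t => (x t, y t)) (dx, dy).
Proof.
move=> /is_derive_cvgP hx /is_derive_cvgP hy; apply/is_derive_cvgP.
exact: (cvg_pair hx hy).
Qed.

Lemma is_derive_fst_coord N (W : normedModType R) (z : R -> 'cV[R]_N * W) dz
    (t : R) i : is_derive t (1 : R) z dz ->
  is_derive t (1 : R) (fun t => (z t).1 i ord0) (dz.1 i ord0).
Proof.
move=> /is_derive_cvgP hz; apply/is_derive_cvgP.
have h1 : (h^-1 *: (z (h *: 1 + t) - z t)).1 @[h --> 0^'] --> dz.1.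
  by apply: cvg_comp hz _; exact: cvg_fst.
have h2 : (h^-1 *: (z (h *: 1 + t) - z t)).1 i ord0 @[h --> 0^'] --> dz.1 i ord0.
  exact: (cvg_comp _ _ h1 (@coord_continuous R N 1 i ord0 dz.1)).
apply: cvg_trans h2; apply: near_eq_cvg.
by near=> s; rewrite /= !mxE.
Unshelve. all: by end_near. Qed.

End Derivatives.

Section ClosedLoop.
Variables (R : realType) (n d : nat) (G : sgraph n).
Local Notation config := 'cV[R]_(n * d).
Local Notation edgevec := 'cV[R]_(nedges G).
Local Notation state := (config * edgevec)%type.
Variables (pstar : config) (mstar : edgevec) (D V : set state).
Variables (nu : state -> 'M[R]_(n * d, nedges G)).
Variables (eta : state -> 'M[R]_(nedges G, nedges G)).
Hypothesis reg_pstar : regular_points R d G pstar.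
Hypothesis mstarE : mstar = distmap G pstar.
Hypothesis D_state : D `<=` state_space R d G.
Hypothesis D_star : D (pstar, mstar).
Hypothesis controller : edge_driven D nu eta.

(** The matrix [nu] as a function of the configuration; [edge_gain] is the
    corresponding form of [eta] imposed by tangency to the state space. *)
Definition gain (p : config) := nu (p, distmap G p).
Definition node_field (p : config) := gain p *m (mstar - distmap G p).
Definition edge_gain (p : config) := 2 *: (rigidity_mx G p *m gain p).

Lemma eta_mulE p (x : edgevec) : D (p, distmap G p) ->
  eta (p, distmap G p) *m x = edge_gain p *m x.
Proof.
move=> Dp; have := controller Dp x; rewrite /state_tangent /= => ->.
by rewrite /edge_gain -scalemxAl mulmxA.
Qed.

Hypothesis V_nbhd : nbhd_in (state_space R d G) (pstar, mstar) V.
Hypothesis nu_rational : rational_mx_on V nu.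

Lemma graph_in_V : exists2 e, 0 < e &
  forall p, `|p - pstar| <= e -> V (p, distmap G p).
Proof.
have [_ /nbhs_closed_ball[e e0 he]] := V_nbhd.
have [a a0 ha] := regular_points_open reg_pstar.
have [b b0 hb] := loc_lip_mx_close (@loc_lip_distmap R n d G pstar) e0.
exists (Num.min e (Num.min a b)); first by rewrite !lt_min e0 a0.
move=> p; rewrite !le_min => /and3P[pe /ha rp /hb pb].
apply: he.
  by rewrite /Num.norm /= ge_max pe mstarE.
by split.
Qed.

Lemma loc_lip_gain : loc_lip_mx pstar gain.
Proof.
have [e e0 he] := graph_in_V.
move=> i j; have [P [Q PQ]] := nu_rational i j.
pose v (p : config) k := col_mx p (distmap G p) k ord0 : R.
have lv k : loc_lip pstar (fun p => v p k).
  rewrite /v -(splitK k); case: (fintype.split k) => l /=.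
    by under eq_fun do rewrite col_mxEu; exact: loc_lip_coord.
  by under eq_fun do rewrite col_mxEd; exact: loc_lip_distmap.
apply: (@loc_lip_near _ _ _ (fun p => mpoly.meval (v p) P / mpoly.meval (v p) Q) _ e e0).
  by move=> p /he/PQ[_].
apply: loc_lipM; first exact: loc_lip_meval.
apply: loc_lipV; last exact: loc_lip_meval.
have /he/PQ[] : `|pstar - pstar| <= e by rewrite subrr normr0 ltW.
by [].
Qed.

Lemma loc_lip_err : loc_lip_mx pstar (fun p => mstar - distmap G p).
Proof. by apply: loc_lip_mxB; [exact: loc_lip_mx_cst|exact: loc_lip_distmap]. Qed.

Lemma loc_lip_edge_gain : loc_lip_mx pstar edge_gain.
Proof.
apply: loc_lip_mxZ; apply: loc_lip_mxM; first exact: loc_lip_rigidity_mx.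
exact: loc_lip_gain.
Qed.

Hypothesis eta_posdef : posdef_on (eta (pstar, mstar))
  (tangent_space (regular_values R d G) mstar).

(** The error is in the image of the rigidity matrix at the midpoint of [p] and
    [pstar], where the form remains coercive. *)
Lemma err_coercive : exists c e, [/\ 0 < c, 0 < e & forall p,
  `|p - pstar| <= e ->
  c * inner (mstar - distmap G p) (mstar - distmap G p) <=
  inner (mstar - distmap G p) (edge_gain p *m (mstar - distmap G p))].
Proof.
pose A p := rigidity_mx G (2^-1 *: (p + pstar)).
have Astar : A pstar = rigidity_mx G pstar.
  by congr rigidity_mx; rewrite scalerDr -scalerDl -[RHS]scale1r; congr (_ *: _); field.
have lA : loc_lip_mx pstar A.
  move=> i j; apply: (@loc_lip_midpoint _ _ _ (fun p => rigidity_mx G p i j)).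
  exact: loc_lip_rigidity_mx.
have [||c [e [c0 e0 h]]] := coercive_on_image lA loc_lip_edge_gain.
- move=> p; rewrite Astar.
  have [_ _ ->] := reg_pstar => //; exact: rank_rigidity_le.
- move=> u; rewrite Astar => x0; rewrite -eta_mulE -?mstarE //.
  apply: eta_posdef => //; rewrite mstarE; exact: rigidity_image_tangent.
exists c, e; split => // p pe.
have -> : mstar - distmap G p = A p *m ((- 2) *: (p - pstar)).
  rewrite mstarE -opprB distmap_midpoint -scalemxAr scaleNr.
  by rewrite -/(A p).
exact: h.
Qed.

Hypothesis rigid : locally_rigid G pstar.
Hypothesis V_sub : V `<=` D.

Let mem_D_distmap s : D s -> s.2 = distmap G s.1.
Proof. by move=> /D_state[_ _ ->]. Qed.

(** Every competing solution obeys the same autonomous equation, because the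
    edge vector of a state is the distance map of its configuration. This
    holds on all of [D], where the field need not be continuous. *)
Lemma solution_node_ode s0 (T : \bar R) w t :
  solution_upto D nu eta mstar s0 T w -> 0 <= t -> (t%:E < T)%E ->
  ode_on node_field t (fun r => (w r).1).
Proof.
move=> [_ Dw cw Dvw] t0 tT i; split.
  have cw' : {within `[0, t], continuous w}.
    apply: continuous_subspaceW cw => r /=; rewrite in_itv /= => /andP[r0 rt].
    by split => //; apply: le_lt_trans tT; rewrite lee_fin.
  move=> r.
  have phi : {for w r, continuous (fun s : state => s.1 i ord0)}.
    apply: (@cvg_comp _ _ _ fst (fun p : config => p i ord0) _ (nbhs (w r).1)).
      exact: cvg_fst.
    exact: coord_continuous.
  exact: (cvg_comp _ _ (cw' r) phi).
move=> r /andP[r0 rt]; have rT : (r%:E < T)%E.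
  by apply: lt_trans tT; rewrite lte_fin.
have -> : node_field (w r).1 = (control_field nu eta mstar (w r)).1.
  rewrite /node_field /gain -mem_D_distmap; last exact: Dw (ltW r0) rT.
  by case: (w r).
exact: is_derive_fst_coord (Dvw r r0 rT).
Qed.

Lemma node_ode_solution (p : config) (x : R -> config) (e : R) :
  (forall q, `|q - pstar| <= e -> V (q, distmap G q)) ->
  x 0 = p -> (forall i (t : R), 0 <= t ->
    {for t, continuous (fun t => x t i ord0)}) ->
  (forall T, ode_on node_field T x) ->
  (forall t, 0 <= t -> `|x t - pstar| <= e) ->
  solution_upto D nu eta mstar (p, distmap G p) +oo
    (fun t => (x t, distmap G (x t))).
Proof.
move=> inV x0 cx hx bx; split.
- by rewrite x0.
- by move=> t t0 _; apply/V_sub/inV/bx.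
- apply: continuous_in_subspaceT => t /set_mem[/= t0 _].
  have cxt : {for t, continuous x} by apply: cvg_cV => i; exact: cx.
  have cm : distmap G (x s) @[s --> t] --> distmap G (x t).
    apply: cvg_cV => k.
    have cF : {for x t, continuous (fun p => distmap G p k ord0)}.
      by apply: loc_lip_continuous; exact: loc_lip_distmap.
    exact: (cvg_comp _ _ cxt cF).
  exact: (cvg_pair cxt cm).
- move=> t t0 _.
  have Dx i : is_derive t (1 : R) (fun t => x t i ord0) (node_field (x t) i ord0).
    by have [_] := hx (t + 1) i; apply; lra.
  have Dt : D (x t, distmap G (x t)) by apply/V_sub/inV/bx/ltW.
  rewrite /control_field /= eta_mulE //.
  apply: is_derive_pair; first exact: is_derive_cV Dx.
  apply: is_derive_cV => k; have := @is_derive_distmap R n d G x _ t k Dx.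
  by rewrite /node_field mulmxA scalemxAl.
Qed.

(** Convergence and both stability properties are read off the same trajectory
    estimates, so they hold on one neighborhood with common constants. *)
Lemma closed_loop_solutions : exists U C c,
  [/\ nbhd_in (state_space R d G) (pstar, mstar) U, 0 < C, 0 < c &
    forall s0, U s0 -> exists z q,
    [/\ the_solution D nu eta mstar s0 z, congruent pstar q,
        distmap G q = mstar,
        forall t, 0 <= t -> enorm (mstar - (z t).2) <= C * expR (- (c * t)) &
        forall t, 0 <= t -> `|(z t).1 - q| <= C * expR (- (c * t))]].
Proof.
have [e1 e10 inV] := graph_in_V.
have [c [e2 [c0 e20 coer]]] := err_coercive.
have [B [e3 [B0 e30 gB]]] := loc_lip_mx_bounded loc_lip_gain.
have [L0 [e4 [L00 e40 lip]]] := loc_lip_mx_lipschitz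
  (loc_lip_mxM loc_lip_gain loc_lip_err).
have [LF [e5 [LF0 e50 lipF]]] := loc_lip_mx_lipschitz (@loc_lip_distmap R n d G pstar).
have [e6 e60 rig] := nbhs_closed_ball rigid.
pose delta := Num.min (Num.min e1 (Num.min e2 e3)) (Num.min e4 (Num.min e5 e6)).
have delta0 : 0 < delta by rewrite !lt_min e10 e20 e30 e40 e50 e60.
have inball p : `|p - pstar| <= delta -> [/\ `|p - pstar| <= e1,
    `|p - pstar| <= e2 & `|p - pstar| <= e3] /\ [/\ `|p - pstar| <= e4,
    `|p - pstar| <= e5 & `|p - pstar| <= e6].
  by rewrite !le_min => /andP[/and3P[-> -> ->] /and3P[-> -> ->]].
pose K := (nedges G)%:R * B.
have K0 : 0 <= K by rewrite mulr_ge0.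
have L0' : 0 < L0 + 1 by rewrite ltr_wpDl.
have g_err p : `|p - pstar| <= delta ->
    2 *: (rigidity_mx G p *m node_field p) = edge_gain p *m (mstar - distmap G p).
  by move=> _; rewrite /edge_gain /node_field -scalemxAl mulmxA.
have g_bound p : `|p - pstar| <= delta ->
    `|node_field p| <= K * enorm (mstar - distmap G p).
  move=> /inball[[_ _ /gB gp] _]; set x := mstar - _.
  apply: mxnorm_le => [|i j]; first by rewrite mulr_ge0 ?enorm_ge0.
  have -> : j = ord0 := ord1 j.
  rewrite mxE; apply: le_trans (ler_norm_sum _ _ _) _.
  apply: le_trans (_ : \sum_(k < nedges G) B * enorm x <= _).
    apply: ler_sum => k _; rewrite normrM ler_pM ?ler_entry_enorm //.
    exact: le_trans (ler_entry_norm _ _ _) gp.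
  by rewrite sumr_const card_ord -mulr_natl mulrA.
have coercive p : `|p - pstar| <= delta ->
    c * inner (mstar - distmap G p) (mstar - distmap G p) <=
    inner (mstar - distmap G p) (edge_gain p *m (mstar - distmap G p)).
  by move=> /inball[[_ /coer + _] _].
have g_star : node_field pstar = 0.
  by rewrite /node_field mstarE subrr mulmx0.
have g_lip p q : `|p - pstar| <= delta -> `|q - pstar| <= delta ->
    `|node_field p - node_field q| <= (L0 + 1) * `|p - q|.
  move=> /inball[_ [pe _ _]] /inball[_ [qe _ _]].
  by apply: le_trans (lip _ _ pe qe) _; rewrite ler_wpM2r // lerDl.
(* An error below [eps] limits the total displacement to [delta / 4]; the bound
   by 1 gives the constant in the decay of the error. *)
pose eps := Num.min 1 (delta / 4 * c / (K + 1)).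
have K1 : 0 < K + 1 by rewrite ltr_wpDl.
have eps0 : 0 < eps by rewrite lt_min ltr01 divr_gt0 ?mulr_gt0 ?divr_gt0.
have E1 : 0 < (nedges G)%:R + 1 :> R by rewrite ltr_wpDl.
have [e7 e70 errs] := loc_lip_mx_close loc_lip_err (divr_gt0 eps0 E1).
have small p : `|p - pstar| <= e7 -> enorm (mstar - distmap G p) <= eps.
  move=> /errs; have -> : mstar - distmap G pstar = 0 by rewrite mstarE subrr.
  rewrite subr0 => le.
  apply: le_trans (enorm_le_norm _ _) _.
  - exact: (ltW (divr_gt0 eps0 E1)).
  - by move=> i; exact: le_trans (ler_entry_norm _ _ _) le.
  rewrite mulrA ler_pdivrMr // mulrC ler_wpM2l ?lerDl // ltW //.
have start p : `|p - pstar| <= Num.min e7 (delta / 4) ->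
    small_start pstar mstar c K delta p.
  rewrite le_min => /andP[/small pe pd]; split => //.
  rewrite ler_pdivrMr //; apply: le_trans (ler_wpM2l K0 pe) _.
  apply: le_trans (_ : (K + 1) * (delta / 4 * c / (K + 1)) <= _).
    by rewrite ler_pM ?(ltW eps0) ?lerDl // /eps ge_min lexx orbT.
  by rewrite mulrC divfK // gt_eqF.
pose U := state_space R d G `&`
  [set s | `|s.1 - pstar| <= Num.min e7 (delta / 4)].
have C1 : 0 < delta / 4 + 1 by rewrite ltr_wpDl // divr_ge0 // ltW.
exists U, (delta / 4 + 1), c; split => //.
  split; first by move=> s [].
  apply: (@closed_ball_nbhs _ _ _ _ (Num.min e7 (delta / 4))).
    by rewrite lt_min e70 divr_gt0.
  move=> s; rewrite /Num.norm /= ge_max => /andP[s1 _] sS; split => //.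
move=> [p m] [[_ _ /= <-] /= pU].
have sp := start _ pU.
have [x [x0 cx hx bx]] := flow_exists c0 g_err g_bound coercive K0 L0' delta0
  g_star g_lip sp.
have sx0 : small_start pstar mstar c K delta (x 0) by rewrite x0.
have [q qd qlim] := flow_limit c0 g_err g_bound coercive K0 delta0 sx0 hx.
have bd t : 0 <= t -> `|x t - pstar| <= delta by move=> /bx; lra.
have decay t : 0 <= t ->
    enorm (mstar - distmap G (x t)) <= expR (- c * t).
  move=> t0; have := err_decay c0 g_err coercive t0 (hx t).
  move=> /(_ (fun r rt => bd r (proj1 (andP rt))))/le_trans; apply.
  rewrite ler_piMl ?expR_ge0 // x0.
  move: pU; rewrite le_min => /andP[/small/le_trans + _]; apply.
  by rewrite /eps ge_min lexx.
have Fq : distmap G q = mstar.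
  apply/esym/eqP; rewrite -subr_eq0; apply/eqP.
  apply/matrixP => k j; have -> : j = ord0 := ord1 j; rewrite [RHS]mxE.
  apply: (@expR_decay_eq0 R _ (1 + LF * (delta / 4)) c) => // t t0.
  rewrite -mulNr mulrDl mul1r.
  have -> : mstar - distmap G q =
    (mstar - distmap G (x t)) + (distmap G (x t) - distmap G q).
    by rewrite addrA subrK.
  rewrite mxE; apply: le_trans (ler_normD _ _) _; apply: lerD.
    exact: le_trans (ler_entry_enorm _ _) (decay t t0).
  apply: le_trans (ler_entry_norm _ _ _) _.
  have [_ [_ xe _]] := inball _ (bd t t0); have [_ [_ qe _]] := inball _ qd.
  apply: le_trans (lipF _ _ xe qe) _.
  by rewrite -mulrA ler_wpM2l // qlim.
exists (fun t => (x t, distmap G (x t))), q; split => //.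
- have sol : solution_upto D nu eta mstar (p, distmap G p) +oo
      (fun t => (x t, distmap G (x t))).
    apply: (@node_ode_solution p x e1) => // t /bd/inball[[+ _ _] _].
    by [].
  split => // T w solw t t0 tT.
  have hw := solution_node_ode solw t0 tT.
  have [w0 Dw _ _] := solw.
  have w0p : (w 0).1 = p by rewrite w0.
  have wx : (w t).1 = x t.
    apply: (flow_unique c0 g_err g_bound coercive K0 L0' delta0 g_lip t0 hw (hx t)).
      by rewrite w0p x0.
    by rewrite w0p; exact: sp.
  have := mem_D_distmap (Dw t t0 tT); rewrite wx.
  by move: wx; case: (w t) => /= a b -> ->.
- apply: rig; last by rewrite Fq.
  by have [_ [_ _ +]] := inball _ qd.
- move=> t t0 /=; apply: le_trans (decay t t0) _; rewrite -mulNr.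
  by rewrite ler_peMl ?expR_ge0 // lerDr divr_ge0 // ltW.
- move=> t t0 /=; apply: le_trans (qlim t t0) _; rewrite -mulNr.
  by rewrite ler_wpM2r ?expR_ge0 // lerDl.
Qed.

End ClosedLoop.

Theorem theorem1 (R : realType) (n d : nat) (G : sgraph n)
    (pstar : 'cV[R]_(n * d)) (mstar : 'cV[R]_(nedges G))
    (D V : set ('cV[R]_(n * d) * 'cV[R]_(nedges G)))
    (nu : 'cV[R]_(n * d) * 'cV[R]_(nedges G) -> 'M[R]_(n * d, nedges G))
    (eta : 'cV[R]_(n * d) * 'cV[R]_(nedges G) -> 'M[R]_(nedges G, nedges G))
    (d_gt0 : (0 < d)%N)
    (rigidG : generically_rigid R d G)
    (reg_pstar : regular_points R d G pstar)
    (mstarE : mstar = distmap G pstar)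
    (D_open : open_in (state_space R d G) D)
    (D_star : D (pstar, mstar))
    (controller : edge_driven D nu eta)
    (V_nbhd : nbhd_in (state_space R d G) (pstar, mstar) V)
    (V_sub : V `<=` D)
    (nu_rational : rational_mx_on V nu)
    (eta_rational : rational_mx_on V eta)
    (eta_posdef : posdef_on (eta (pstar, mstar))
                    (tangent_space (regular_values R d G) mstar)) :
  [/\ locally_convergent D nu eta mstar pstar,
      edge_exp_stable D nu eta mstar pstar &
      node_exp_stable D nu eta mstar pstar].
Proof.
have D_state : D `<=` state_space R d G by case: D_open => O _ -> s [].
have [U [C [c [nU C0 c0 sol]]]] := closed_loop_solutions reg_pstar mstarE D_state
  D_star controller V_nbhd nu_rational eta_posdef (rigidG _ reg_pstar) V_sub.
split; exists U => //.
- move=> s0 /sol[z [q [hz pq Fq de dn]]]; exists z, q; split => //.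
    have rm : regular_values R d G mstar by rewrite mstarE.
    by split => //=; rewrite /regular_points /= Fq.
  have late (e : R) : 0 < e ->
      \forall t \near +oo, 0 <= t /\ C * expR (- (c * t)) < e.
    move=> e0; have [t0 t00 lt] := expR_decay_lt C c0 e0.
    near=> t; have tt : t0 <= t by near: t; apply: nbhs_pinfty_ge; exact: num_real.
    split; first exact: le_trans tt.
    apply: le_lt_trans lt; rewrite ler_wpM2l ?(ltW C0) // ler_expR lerN2.
    by rewrite ler_wpM2l // ltW.
  apply/cvgrPdist_lt => e e0; near=> t.
  have [t0 lt] : 0 <= t /\ C * expR (- (c * t)) < e.
    by near: t; exact: late.
  rewrite /Num.norm /= gt_max; apply/andP; split.
    by rewrite distrC; exact: le_lt_trans (dn t t0) lt.
  apply: le_lt_trans lt; apply: le_trans (de t t0).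
  apply: mxnorm_le => [|i j]; first exact: enorm_ge0.
  by have -> : j = ord0 := ord1 j; exact: ler_entry_enorm.
- exists C, c; split => // s0 /sol[z [q [hz pq Fq de dn]]].
  by exists z.
- exists ((n * d)%:R * C + 1), c; split => //.
    by rewrite ltr_wpDl // mulr_ge0 // ltW.
  move=> s0 /sol[z [q [hz pq Fq de dn]]]; exists z => //; exists q => // t t0.
  apply: le_trans (_ : (n * d)%:R * (C * expR (- (c * t))) <= _).
    apply: enorm_le_norm; first by rewrite mulr_ge0 ?expR_ge0 // ltW.
    by move=> i; apply: le_trans (ler_entry_norm _ _ _) _; rewrite distrC dn.
  by rewrite mulrA ler_wpM2r ?expR_ge0 // lerDl.
Unshelve. all: by end_near. Qed.
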